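(* Let $\Lambda$ be a locally convex, row-finite $k$-graph, let $\tilde\Lambda$ be its desourcification, with canonical embedding $\iota:\Lambda\to\tilde\Lambda$, and let $R$ be a commutative ring with $1$. Let $(q,t)$ be a universal Kumjian-Pask $\tilde\Lambda$-family generating $\mathrm{KP}_R(\tilde\Lambda)$, and let $B(\tilde\Lambda)$ be the subalgebra of $\mathrm{KP}_R(\tilde\Lambda)$ generated by $\{q_{\iota(v)},t_{\iota(\lambda)},t_{\iota(\mu)^*}:v\in\Lambda^0,\ \lambda,\mu\in\Lambda\}$. Let $$M:=\operatorname{span}_R\{t_\lambda t_{\mu^*}:\lambda,\mu\in\tilde\Lambda,\ r(\mu)\in\iota(\Lambda^0)\},\qquad N:=\operatorname{span}_R\{t_\lambda t_{\mu^*}:\lambda,\mu\in\tilde\Lambda,\ r(\lambda)\in\iota(\Lambda^0)\}.$$ Then: (a) $M$ is a $\mathrm{KP}_R(\tilde\Lambda)$--$B(\tilde\Lambda)$ bimodule and $N$ is a $B(\tilde\Lambda)$--$\mathrm{KP}_R(\tilde\Lambda)$ bimodule, with module actions given by multiplication in $\mathrm{KP}_R(\tilde\Lambda)$; (b) there are surjective maps $\psi:M\otimes_{B(\tilde\Lambda)}N\to\mathrm{KP}_R(\tilde\Lambda)$ and $\phi:N\otimes_{\mathrm{KP}_R(\tilde\Lambda)}M\to B(\tilde\Lambda)$ such that $\psi(m\otimes n)=mn$ and $\phi(n\otimes m)=nm$ for $n\in N$ and $m\in M$; (c) $(\mathrm{KP}_R(\tilde\Lambda),B(\tilde\Lambda),M,N,\psi,\phi)$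 is a surjective Morita context between $\mathrm{KP}_R(\tilde\Lambda)$ and $B(\tilde\Lambda)$.
   Context: $\mathbb N=\{0,1,2,\dots\}$, $k\geq 1$ is an integer, $e_1,\dots,e_k$ is the standard basis of $\mathbb N^k$, $\leq$ is coordinatewise and $\wedge$ is the coordinatewise minimum. A $k$-graph is a countable category $\Lambda$ with a functor $d:\Lambda\to\mathbb N^k$ (degree) satisfying the factorisation property: if $d(\lambda)=m+n$ with $m,n\in\mathbb N^k$, there are unique $\mu,\nu\in\Lambda$ with $d(\mu)=m$, $d(\nu)=n$, $\lambda=\mu\nu$. Morphisms are called paths; the set $\Lambda^0$ of objects (vertices) is identified with the set of paths of degree $0$; $r,s:\Lambda\to\Lambda^0$ are the codomain (range) and domain (source) maps, so $\lambda\mu$ is defined iff $s(\lambda)=r(\mu)$. Write $\Lambda^n=d^{-1}(n)$, $\Lambda^{\neq0}=\Lambda\setminus\Lambda^0$, $v\Lambda=\{\lambda:r(\lambda)=v\}$, $v\Lambda^n=v\Lambda\cap\Lambda^n$. $\Lambda$ is row-finite if every $v\Lambda^n$ is finite. $\Lambda$ is locally convex if for all $v\in\Lambda^0$, $i\neq j$, $\lambda\in v\Lambda^{e_i}$, $\mu\in v\Lambda^{e_j}$, the sets $s(\lambda)\Lambda^{e_j}$ and $s(\mu)\Lambda^{e_i}$ are nonempty. For $n\in\mathbb N^k$, $\Lambda^{\leq n}=\{\lambda\in\Lambda: d(\lambda)\leq n,\text{ and } d(\lambda)_i<n_i\text{ implies } s(\lambda)\Lambda^{e_i}=\emptyset\}$,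 and $v\Lambda^{\leq n}=v\Lambda\cap\Lambda^{\leq n}$. Boundary paths: for $m\in(\mathbb N\cup\{\infty\})^k$ let $\Omega_{k,m}$ be the $k$-graph with objects $\{p\in\mathbb N^k:p\leq m\}$, morphisms $(p,q)$ with $p\leq q\leq m$, $r(p,q)=p$, $s(p,q)=q$, $d(p,q)=q-p$. A boundary path of degree $m$ is a degree-preserving functor $x:\Omega_{k,m}\to\Lambda$ such that whenever $p\leq m$ and $p_i=m_i$ we have $x(p)\Lambda^{e_i}=\emptyset$, where $x(p):=x(p,p)$. Write $d(x)=m$, $r(x)=x(0)$; $\Lambda^{\leq\infty}$ is the set of boundary paths. For $n\leq d(x)$, $\sigma^n(x)$ is the boundary path $(p,q)\mapsto x(n+p,n+q)$ of degree $d(x)-n$. If $s(\lambda)=r(x)$, $\lambda x$ is the boundary path of degree $d(\lambda)+d(x)$ with $(\lambda x)(0,d(\lambda))=\lambda$ and $\sigma^{d(\lambda)}(\lambda x)=x$. Desourcification: on $\{(x;m):x\in\Lambda^{\leq\infty},m\in\mathbb N^k\}$ put $(x;m)\approx(y;p)$ iff $x(m\wedge d(x))=y(p\wedge d(y))$ and $m-m\wedge d(x)=p-p\wedge d(y)$. On $\{(x;(m,n)):x\in\Lambda^{\leq\infty},m\leq n\in\mathbb N^k\}$ put $(x;(m,n))\sim(y;(p,q))$ iff $x(m\wedge d(x),n\wedge d(x))=y(p\wedge d(y),q\wedge d(y))$, $m-m\wedge d(x)=p-p\wedge d(y)$ and $n-m=q-p$. These are equivalence relations with classes $[x;m]$,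 $[x;(m,n)]$. The desourcification $\tilde\Lambda$ is the $k$-graph with vertices $[x;m]$, paths $[x;(m,n)]$, $r([x;(m,n)])=[x;m]$, $s([x;(m,n)])=[x;n]$, identities $[x;(m,m)]$, degree $d([x;(m,n)])=n-m$, and composition $[x;(m,n)]\circ[y;(p,q)]=[x(0,n\wedge d(x))\,\sigma^{p\wedge d(y)}(y);(m,n+q-p)]$ when $[x;n]=[y;p]$. It is a well-defined row-finite $k$-graph without sources (all $v\tilde\Lambda^n\ne\emptyset$). The map $\iota(\lambda)=[\lambda x;(0,d(\lambda))]$, for any $x\in\Lambda^{\leq\infty}$ with $r(x)=s(\lambda)$, is a well-defined injective degree-preserving functor $\Lambda\to\tilde\Lambda$. Kumjian-Pask families (for a locally convex, row-finite $k$-graph $\Gamma$, e.g. $\Gamma=\Lambda$ or $\tilde\Lambda$): for each $\lambda\in\Gamma^{\neq 0}$ let $\lambda^*$ be a formal symbol; for $v\in\Gamma^0$ put $v^*=v$. $R$-algebras are associative but need not be unital. A Kumjian-Pask $\Gamma$-family $(P,S)$ in an $R$-algebra $A$ consists of elements $P_v$ ($v\in\Gamma^0$), $S_\lambda,S_{\lambda^*}$ ($\lambda\in\Gamma^{\neq0}$) of $A$ such that, with the convention $S_v=S_{v^*}=P_v$: (KP1) $P_vP_w=\delta_{v,w}P_v$; (KP2) $S_\lambda S_\mu=S_{\lambda\mu}$ and $S_{\mu^*}S_{\lambda^*}=S_{(\lambda\mu)^*}$ when $r(\mu)=s(\lambda)$, and $P_{r(\lambda)}S_\lambda=S_\lambda=S_\lambda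 P_{s(\lambda)}$, $P_{s(\lambda)}S_{\lambda^*}=S_{\lambda^*}=S_{\lambda^*}P_{r(\lambda)}$; (KP3$'$) $S_{\lambda^*}S_\mu=\delta_{\lambda,\mu}P_{s(\lambda)}$ for all $n\in\mathbb N^k\setminus\{0\}$ and $\lambda,\mu\in\Gamma^{\leq n}$; (KP4$'$) $P_v=\sum_{\lambda\in v\Gamma^{\leq n}}S_\lambda S_{\lambda^*}$ for all $v\in\Gamma^0$, $n\in\mathbb N^k\setminus\{0\}$. (If $\Gamma$ has no sources then $\Gamma^{\leq n}=\Gamma^n$.) $\mathrm{KP}_R(\Gamma)$ is the $R$-algebra generated by a universal Kumjian-Pask $\Gamma$-family. Morita context: for rings $A,B$ (not necessarily unital), an $A$--$B$ bimodule $M$, a $B$--$A$ bimodule $N$, and bimodule homomorphisms $\psi:M\otimes_BN\to A$, $\phi:N\otimes_AM\to B$ satisfying $n'\cdot\psi(m\otimes n)=\phi(n'\otimes m)\cdot n$ and $m'\cdot\phi(n\otimes m)=\psi(m'\otimes n)\cdot m$ for all $m,m'\in M$, $n,n'\in N$, the tuple $(A,B,M,N,\psi,\phi)$ is a Morita context; it is surjective if $\psi$ and $\phi$ are surjective. *)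

(* Defs.v *)
From HB Require Import structures.
From mathcomp Require Import all_boot all_order all_algebra.
From mathcomp Require Import all_classical.

Set Implicit Arguments.
Unset Strict Implicit.
Unset Printing Implicit Defensive.

Import GRing.Theory.
Local Open Scope classical_set_scope.
Local Open Scope ring_scope.
Local Open Scope quotient_scope.

Notation degree k := {ffun 'I_k -> nat}.

(* Elements of (N \cup {oo})^k; [None] stands for oo. *)
Notation xdegree k := {ffun 'I_k -> option nat}.

Section Degrees.
Context {k : nat}.
Implicit Types (m n : degree k) (M : xdegree k).

Definition dle m n : bool := [forall i, (m i <= n i)%N].

(* Only used for n <= m, or as m - (m /\ M): the truncation is harmless. *)
Definition dsub m n : degree k := [ffun i => (m i - n i)%N].

Definition unitd (j : 'I_k) : degree k := [ffun i => nat_of_bool (i == j)].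

Definition xdle m M : bool :=
  [forall i, if M i is Some a then (m i <= a)%N else true].

Definition meetx m M : degree k :=
  [ffun i => if M i is Some a then minn (m i) a else m i].

Definition xsub M n : xdegree k := [ffun i => omap (subn^~ (n i)) (M i)].

Definition xadd n M : xdegree k := [ffun i => omap (addn (n i)) (M i)].

End Degrees.

(* [kcomp l mu] is the paper's "l mu"; it is meaningful only when
   [src l = rng mu], and no axiom constrains it otherwise. *)
Record kgraph_data (k : nat) := KGraphData {
  obj : choiceType;
  kpath : choiceType;
  rng : kpath -> obj;
  src : kpath -> obj;
  idp : obj -> kpath;
  kcomp : kpath -> kpath -> kpath;
  deg : kpath -> degree k }.

Arguments rng {k _}.
Arguments src {k _}.
Arguments idp {k _}.
Arguments kcomp {k _}.
Arguments deg {k _}.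

Section KGraph.
Context {k : nat}.
Implicit Type L : kgraph_data k.

Record kgraph_axioms L : Prop := KGraphAxioms {
  rng_id : forall v : obj L, rng (idp v) = v;
  src_id : forall v : obj L, src (idp v) = v;
  rng_comp : forall l mu : kpath L, src l = rng mu -> rng (kcomp l mu) = rng l;
  src_comp : forall l mu : kpath L, src l = rng mu -> src (kcomp l mu) = src mu;
  compA : forall l mu nu : kpath L, src l = rng mu -> src mu = rng nu ->
    kcomp l (kcomp mu nu) = kcomp (kcomp l mu) nu;
  comp_idl : forall l : kpath L, kcomp (idp (rng l)) l = l;
  comp_idr : forall l : kpath L, kcomp l (idp (src l)) = l;
  deg_id : forall v : obj L, deg (idp v) = 0;
  deg_comp : forall l mu : kpath L, src l = rng mu ->
    deg (kcomp l mu) = deg l + deg mu;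
  factorisation : forall (l : kpath L) (m n : degree k), deg l = m + n ->
    exists! mn : kpath L * kpath L,
      [/\ deg mn.1 = m, deg mn.2 = n, src mn.1 = rng mn.2
        & l = kcomp mn.1 mn.2];
  countable_kpath : countable [set: kpath L] }.

(* v L^n *)
Definition paths_from L (v : obj L) (n : degree k) : set (kpath L) :=
  [set l | rng l = v /\ deg l = n].

(* L^{<= n} *)
Definition le_paths L (n : degree k) : set (kpath L) :=
  [set l | dle (deg l) n /\
     forall i, (deg l i < n i)%N -> paths_from (src l) (unitd i) = set0].

(* v L^{<= n} *)
Definition le_paths_from L (v : obj L) (n : degree k) : set (kpath L) :=
  [set l | rng l = v] `&` le_paths n.

Definition row_finite L : Prop :=
  forall (v : obj L) (n : degree k), finite_set (paths_from v n).

Definition locally_convex L : Prop :=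
  forall (v : obj L) (i j : 'I_k) (l mu : kpath L), i != j ->
    paths_from v (unitd i) l -> paths_from v (unitd j) mu ->
    paths_from (src l) (unitd j) !=set0 /\
    paths_from (src mu) (unitd i) !=set0.

End KGraph.

Record kgraph (k : nat) := KGraph {
  kgraph_sort :> kgraph_data k;
  kgraphP : kgraph_axioms kgraph_sort }.

(* The data of a functor Omega_{k,m} -> L: [pdeg] is m, [pobj p] is x(p) and
   [ppath p q] is x(p,q).  Only the values at p <= q <= m are meaningful. *)
Record omega_map (k : nat) (L : kgraph_data k) := OmegaMap {
  pdeg : xdegree k;
  pobj : degree k -> obj L;
  ppath : degree k -> degree k -> kpath L }.

Section BoundaryPaths.
Context {k : nat} {L : kgraph_data k}.
Implicit Types (x y z : omega_map L) (n : degree k).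

Record omega_functor x : Prop := OmegaFunctor {
  rng_ppath : forall p q, dle p q -> xdle q (pdeg x) ->
    rng (ppath x p q) = pobj x p;
  src_ppath : forall p q, dle p q -> xdle q (pdeg x) ->
    src (ppath x p q) = pobj x q;
  deg_ppath : forall p q, dle p q -> xdle q (pdeg x) ->
    deg (ppath x p q) = dsub q p;
  ppath_id : forall p, xdle p (pdeg x) -> ppath x p p = idp (pobj x p);
  ppath_comp : forall p q l, dle p q -> dle q l -> xdle l (pdeg x) ->
    kcomp (ppath x p q) (ppath x q l) = ppath x p l }.

Definition is_boundary_path x : Prop :=
  omega_functor x /\
  forall (p : degree k) (i : 'I_k), xdle p (pdeg x) ->
    Some (p i) = pdeg x i -> paths_from (pobj x p) (unitd i) = set0.

(* Equality as functors, ignoring the meaningless values. *)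
Definition omega_eq x y : Prop :=
  [/\ pdeg x = pdeg y,
      forall p, xdle p (pdeg x) -> pobj x p = pobj y p
    & forall p q, dle p q -> xdle q (pdeg x) -> ppath x p q = ppath y p q].

(* sigma^n(x) *)
Definition shift n x : omega_map L :=
  OmegaMap (xsub (pdeg x) n) (fun p => pobj x (n + p))
           (fun p q => ppath x (n + p) (n + q)).

(* z = l x *)
Definition is_concat (l : kpath L) x z : Prop :=
  [/\ pdeg z = xadd (deg l) (pdeg x), ppath z 0 (deg l) = l
    & omega_eq (shift (deg l) z) x].

End BoundaryPaths.

Record boundary_path (k : nat) (L : kgraph_data k) := BoundaryPath {
  boundary_path_map :> omega_map L;
  boundary_pathP : is_boundary_path boundary_path_map }.

HB.instance Definition _ (k : nat) (L : kgraph_data k) :=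
  gen_eqMixin (boundary_path L).
HB.instance Definition _ (k : nat) (L : kgraph_data k) :=
  gen_choiceMixin (boundary_path L).

Section Desourcification.
Context {k : nat} (L : kgraph_data k).

Definition pre_obj : choiceType := (boundary_path L * degree k)%type.

(* [(x, m, n)] encodes (x;(m,n)). *)
Definition pre_path : choiceType :=
  {t : boundary_path L * degree k * degree k | dle t.1.2 t.2}.

Definition pre_base (t : pre_path) : boundary_path L := (val t).1.1.
Definition pre_start (t : pre_path) : degree k := (val t).1.2.
Definition pre_end (t : pre_path) : degree k := (val t).2.

Definition obj_rel (a b : pre_obj) : bool :=
  let: (x, m) := a in let: (y, p) := b in
  (pobj x (meetx m (pdeg x)) == pobj y (meetx p (pdeg y))) &&
  (dsub m (meetx m (pdeg x)) == dsub p (meetx p (pdeg y))).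

Definition path_rel (a b : pre_path) : bool :=
  let x := pre_base a in let m := pre_start a in let n := pre_end a in
  let y := pre_base b in let p := pre_start b in let q := pre_end b in
  [&& ppath x (meetx m (pdeg x)) (meetx n (pdeg x))
        == ppath y (meetx p (pdeg y)) (meetx q (pdeg y)),
      dsub m (meetx m (pdeg x)) == dsub p (meetx p (pdeg y))
    & dsub n m == dsub q p].

Lemma obj_rel_refl : reflexive obj_rel.
Proof. by move=> [x m] /=; rewrite !eqxx. Qed.

Lemma obj_rel_sym : symmetric obj_rel.
Proof.
by move=> [x m] [y p] /=; rewrite eq_sym [dsub m _ == _]eq_sym.
Qed.

Lemma obj_rel_trans : transitive obj_rel.
Proof.
by move=> [y p] [x m] [z l] /= /andP[/eqP-> /eqP->] /andP[/eqP-> /eqP->];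
  rewrite !eqxx.
Qed.

Canonical obj_equiv := EquivRel obj_rel obj_rel_refl obj_rel_sym obj_rel_trans.

Lemma path_rel_refl : reflexive path_rel.
Proof. by move=> a; rewrite /path_rel !eqxx. Qed.

Lemma path_rel_sym : symmetric path_rel.
Proof.
by move=> a b; rewrite /path_rel /=; congr [&& _, _ & _]; rewrite eq_sym.
Qed.

Lemma path_rel_trans : transitive path_rel.
Proof.
move=> b a c; rewrite /path_rel /=.
move=> /and3P[/eqP-> /eqP-> /eqP->] /and3P[/eqP-> /eqP-> /eqP->].
by rewrite !eqxx.
Qed.

Canonical path_equiv :=
  EquivRel path_rel path_rel_refl path_rel_sym path_rel_trans.

Definition ds_obj : choiceType := {eq_quot obj_equiv}.
Definition ds_path : choiceType := {eq_quot path_equiv}.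

(* [x;m] *)
Definition cls_obj (x : boundary_path L) (m : degree k) : ds_obj :=
  \pi_{eq_quot obj_equiv} (x, m).

(* [x;(m,n)] *)
Definition cls_path (x : boundary_path L) (m n : degree k) (mn : dle m n) :
    ds_path :=
  \pi_{eq_quot path_equiv} (exist _ (x, m, n) mn : pre_path).

(* r, s, the identities and d are read off a representative chosen by [repr];
   the choice is immaterial. *)
Definition ds_rep (c : ds_path) : pre_path := repr (c : {eq_quot path_equiv}).

Definition ds_rng (c : ds_path) : ds_obj :=
  cls_obj (pre_base (ds_rep c)) (pre_start (ds_rep c)).

Definition ds_src (c : ds_path) : ds_obj :=
  cls_obj (pre_base (ds_rep c)) (pre_end (ds_rep c)).

Definition ds_deg (c : ds_path) : degree k :=
  dsub (pre_end (ds_rep c)) (pre_start (ds_rep c)).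

Lemma dle_refl (m : degree k) : dle m m.
Proof. by apply/forallP => i. Qed.

Lemma dle0 (m : degree k) : dle 0 m.
Proof. by apply/forallP => i; rewrite ffunE. Qed.

Definition ds_id (v : ds_obj) : ds_path :=
  let xm := repr (v : {eq_quot obj_equiv}) in cls_path xm.1 (dle_refl xm.2).

(* h = [x(0, n /\ d(x)) sigma^{p /\ d(y)}(y); (m, n + q - p)] for some
   f = [x;(m,n)] and g = [y;(p,q)] such that [x;n] = [y;p]. *)
Definition ds_comp_rel (f g h : ds_path) : Prop :=
  exists (x y z : boundary_path L) (m n p q : degree k)
      (mn : dle m n) (pq : dle p q) (ml : dle m (dsub (n + q) p)),
    [/\ f = cls_path x mn, g = cls_path y pq, cls_obj x n = cls_obj y p,
        is_concat (ppath x 0 (meetx n (pdeg x)))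
          (shift (meetx p (pdeg y)) y) z
      & h = cls_path z ml].

(* The path [h] above is unique, and exists as soon as [ds_src f = ds_rng g];
   otherwise the value of [ds_comp f g] is irrelevant. *)
Definition ds_comp (f g : ds_path) : ds_path := xget f (ds_comp_rel f g).

Definition desource : kgraph_data k :=
  KGraphData ds_rng ds_src ds_id ds_comp ds_deg.

(* The functor iota: L -> desource L, with object part [iota0] and morphism
   part [iota1]. *)
Definition canonical_embedding
    (iota0 : obj L -> obj desource) (iota1 : kpath L -> kpath desource) : Prop :=
  (forall v : obj L, iota1 (idp v) = idp (iota0 v)) /\
  (forall (l : kpath L) (x z : boundary_path L),
     pobj x 0 = src l -> is_concat l x z -> iota1 l = cls_path z (dle0 (deg l))).

End Desourcification.

HB.mixin Record Zmodule_isNURing V of GRing.Zmodule V := {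
  numul : V -> V -> V;
  numulA : associative numul;
  numulDl : left_distributive numul +%R;
  numulDr : right_distributive numul +%R }.

#[short(type="nuRingType")]
HB.structure Definition NURing := {V of GRing.Zmodule V & Zmodule_isNURing V}.

Notation "x ** y" := (numul x y) (at level 40, left associativity) : ring_scope.

HB.mixin Record NURing_Lmodule_isNUAlg (R : pzRingType) V
    of NURing V & GRing.Lmodule R V := {
  nuscaleAl : forall (a : R) (x y : V), a *: (x ** y) = (a *: x) ** y;
  nuscaleAr : forall (a : R) (x y : V), a *: (x ** y) = x ** (a *: y) }.

#[short(type="nuAlgType")]
HB.structure Definition NUAlgebra (R : pzRingType) :=
  {V of NURing V & GRing.Lmodule R V & NURing_Lmodule_isNUAlg R V}.

Definition nualg_hom (R : pzRingType) (A B : nuAlgType R) (f : A -> B) : Prop :=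
  linear f /\ {morph f : x y / x ** y}.

Section Span.
Context {R : pzRingType} {V : lmodType R}.

Definition is_submodule (W : set V) : Prop :=
  [/\ W 0, forall u v, W u -> W v -> W (u + v)
    & forall (a : R) u, W u -> W (a *: u)].

Definition in_lspan (X : set V) : {pred V} := fun a =>
  `[< exists (n : nat) (c : 'I_n -> R) (u : 'I_n -> V),
        (forall i, X (u i)) /\ a = \sum_(i < n) c i *: u i >].

Lemma in_lspan_closed (X : set V) : GRing.subsemimod_closed (in_lspan X).
Proof.
split; first split.
- by apply/asboolP; exists 0%N, (fun=> 0), (fun=> 0); split=> [[]//|];
    rewrite big_ord0.
- move=> _ _ /asboolP[n [c [u [Xu ->]]]] /asboolP[m [d [w [Xw ->]]]].
  apply/asboolP; exists (n + m)%N.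
  exists (fun i : 'I_(n + m) => match fintype.split i with inl j => c j | inr j => d j end).
  exists (fun i : 'I_(n + m) => match fintype.split i with inl j => u j | inr j => w j end).
  split=> [i|]; first by case: (fintype.split i).
  rewrite big_split_ord /=; congr (_ + _); apply: eq_bigr => i _.
    by have /= -> := unsplitK (inl i : 'I_n + 'I_m).
  by have /= -> := unsplitK (inr i : 'I_n + 'I_m).
- move=> a _ /asboolP[n [c [u [Xu ->]]]].
  apply/asboolP; exists n, (fun i => a * c i), u; split=> //.
  by rewrite scaler_sumr; apply: eq_bigr => i _; rewrite scalerA.
Qed.

HB.instance Definition _ (X : set V) :=
  GRing.isSubSemiModClosed.Build R V (in_lspan X) (in_lspan_closed X).

Record lspan (X : set V) := LSpan {
  lspan_val :> V;
  lspan_valP : lspan_val \in in_lspan X }.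

HB.instance Definition _ X := [isSub for @lspan_val X].
HB.instance Definition _ X := [Choice of lspan X by <:].
HB.instance Definition _ X := [SubChoice_isSubLmodule of lspan X by <:].

End Span.

Section Subalgebra.
Context {R : pzRingType} {A : nuAlgType R}.

Definition is_subalgebra (W : set A) : Prop :=
  is_submodule W /\ forall x y, W x -> W y -> W (x ** y).

Definition subalgebra_gen (X : set A) : set A :=
  [set a | forall W, is_subalgebra W -> X `<=` W -> W a].

Definition in_subalg (X : set A) : {pred A} := fun a => `[< subalgebra_gen X a >].

Lemma in_subalg_closed (X : set A) : GRing.subsemimod_closed (in_subalg X).
Proof.
split; first split.
- by apply/asboolP => W [[W0 WD WZ] WM] XW.
- move=> x y /asboolP Xx /asboolP Xy; apply/asboolP => W sW XW.
  by case: (sW) => [[W0 WD WZ] WM]; apply: WD; [exact: Xx | exact: Xy].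
- move=> a x /asboolP Xx; apply/asboolP => W sW XW.
  by case: (sW) => [[W0 WD WZ] WM]; apply: WZ; exact: Xx.
Qed.

Lemma in_subalgM (X : set A) (x y : A) :
  x \in in_subalg X -> y \in in_subalg X -> x ** y \in in_subalg X.
Proof.
move=> /asboolP Xx /asboolP Xy; apply/asboolP => W sW XW.
by case: (sW) => _; apply; [exact: Xx | exact: Xy].
Qed.

HB.instance Definition _ (X : set A) :=
  GRing.isSubSemiModClosed.Build R A (in_subalg X) (in_subalg_closed X).

Record gen_subalg (X : set A) := GenSubalg {
  gen_subalg_val :> A;
  gen_subalg_valP : gen_subalg_val \in in_subalg X }.

HB.instance Definition _ X := [isSub for @gen_subalg_val X].
HB.instance Definition _ X := [Choice of gen_subalg X by <:].
HB.instance Definition _ X := [SubChoice_isSubLmodule of gen_subalg X by <:].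

Section Instances.
Variable X : set A.

Definition subalg_mul (x y : gen_subalg X) : gen_subalg X :=
  GenSubalg (in_subalgM (gen_subalg_valP x) (gen_subalg_valP y)).

Fact subalg_mulA : associative subalg_mul.
Proof. by move=> x y z; apply: val_inj; rewrite /= numulA. Qed.

Fact subalg_mulDl : left_distributive subalg_mul +%R.
Proof. by move=> x y z; apply: val_inj; rewrite /= numulDl. Qed.

Fact subalg_mulDr : right_distributive subalg_mul +%R.
Proof. by move=> x y z; apply: val_inj; rewrite /= numulDr. Qed.

HB.instance Definition _ := Zmodule_isNURing.Build (gen_subalg X)
  subalg_mulA subalg_mulDl subalg_mulDr.

Fact subalg_scaleAl (a : R) (x y : gen_subalg X) : a *: (x ** y) = (a *: x) ** y.
Proof. by apply: val_inj; rewrite /= nuscaleAl. Qed.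

Fact subalg_scaleAr (a : R) (x y : gen_subalg X) : a *: (x ** y) = x ** (a *: y).
Proof. by apply: val_inj; rewrite /= nuscaleAr. Qed.

HB.instance Definition _ := NURing_Lmodule_isNUAlg.Build R (gen_subalg X)
  subalg_scaleAl subalg_scaleAr.

End Instances.
End Subalgebra.

Section KumjianPask.
Context {k : nat} {G : kgraph_data k} {R : comPzRingType}.

(* [S l] and [Sst l] stand for S_l and S_{l^*}.  Both are defined on all of G;
   the first two clauses are the convention S_v = S_{v^*} = P_v. *)
Record KP_family (A : nuAlgType R) (P : obj G -> A) (S Sst : kpath G -> A) :
    Prop := KPFamily {
  KP_S_id : forall v, S (idp v) = P v;
  KP_Sst_id : forall v, Sst (idp v) = P v;
  KP1 : forall v w, P v ** P w = if v == w then P v else 0;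
  KP2_comp : forall l mu, src l = rng mu -> S l ** S mu = S (kcomp l mu);
  KP2_comp_st : forall l mu, src l = rng mu ->
    Sst mu ** Sst l = Sst (kcomp l mu);
  KP2_rng : forall l, P (rng l) ** S l = S l;
  KP2_src : forall l, S l ** P (src l) = S l;
  KP2_src_st : forall l, P (src l) ** Sst l = Sst l;
  KP2_rng_st : forall l, Sst l ** P (rng l) = Sst l;
  KP3 : forall n : degree k, n != 0 -> forall l mu,
    le_paths n l -> le_paths n mu ->
    Sst l ** S mu = if l == mu then P (src l) else 0;
  KP4 : forall (v : obj G) (n : degree k), n != 0 ->
    P v = \sum_(l \in le_paths_from v n) (S l ** Sst l) }.

(* [A], with the family [P, S, Sst], is KP_R(G). *)
Definition universal_KP_family (A : nuAlgType R) (P : obj G -> A)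
    (S Sst : kpath G -> A) : Prop :=
  [/\ KP_family P S Sst,
      subalgebra_gen (range P `|` range S `|` range Sst) = setT
    & forall (B : nuAlgType R) (Q : obj G -> B) (T Tst : kpath G -> B),
        KP_family Q T Tst ->
        exists! f : A -> B, nualg_hom f /\
          [/\ forall v, f (P v) = Q v, forall l, f (S l) = T l
            & forall l, f (Sst l) = Tst l]].

End KumjianPask.

Record bimodule (A B : nuRingType) (M : zmodType) := Bimodule {
  lact : A -> M -> M;
  ract : M -> B -> M;
  lactDl : forall a a' m, lact (a + a') m = lact a m + lact a' m;
  lactDr : forall a m m', lact a (m + m') = lact a m + lact a m';
  lactA : forall a a' m, lact (a ** a') m = lact a (lact a' m);
  ractDl : forall m m' b, ract (m + m') b = ract m b + ract m' b;
  ractDr : forall m b b', ract m (b + b') = ract m b + ract m b';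
  ractA : forall m b b', ract m (b ** b') = ract (ract m b) b';
  lractA : forall a m b, ract (lact a m) b = lact a (ract m b) }.

Definition bimodule_hom (A B : nuRingType) (X Y : zmodType)
    (bX : bimodule A B X) (bY : bimodule A B Y) (f : X -> Y) : Prop :=
  [/\ {morph f : x y / x + y},
      forall a x, f (lact bX a x) = lact bY a (f x)
    & forall x b, f (ract bX x b) = ract bY (f x) b].

Definition ring_bimodule (A : nuRingType) : bimodule A A A :=
  @Bimodule A A A numul numul numulDl (fun a m m' => numulDr a m m')
    (fun a a' m => esym (numulA a a' m)) numulDl (fun m b b' => numulDr m b b')
    (fun m b b' => numulA m b b') (fun a m b => esym (numulA a m b)).

(* The additive group of the tensor product of M and N over B: formal sums of
   pairs, that is sequences of pairs, modulo the congruence generated by the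
   tensor relations. *)
Section Tensor.
Context {A B C : nuRingType} {M N : zmodType}.
Variables (bM : bimodule A B M) (bN : bimodule B C N).

Inductive tensor_eqv : seq (M * N) -> seq (M * N) -> Prop :=
| tensor_refl s : tensor_eqv s s
| tensor_sym s t : tensor_eqv s t -> tensor_eqv t s
| tensor_trans t s u : tensor_eqv s t -> tensor_eqv t u -> tensor_eqv s u
| tensor_cat s s' t t' :
    tensor_eqv s s' -> tensor_eqv t t' -> tensor_eqv (s ++ t) (s' ++ t')
| tensor_comm s t : tensor_eqv (s ++ t) (t ++ s)
| tensor_0l n : tensor_eqv [:: (0, n)] [::]
| tensor_Dl m m' n : tensor_eqv [:: (m + m', n)] [:: (m, n); (m', n)]
| tensor_Dr m n n' : tensor_eqv [:: (m, n + n')] [:: (m, n); (m, n')]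
| tensor_bal m b n :
    tensor_eqv [:: (ract bM m b, n)] [:: (m, lact bN b n)].

Definition tensor_rel (s t : seq (M * N)) : bool := `[< tensor_eqv s t >].

Fact tensor_rel_refl : reflexive tensor_rel.
Proof. by move=> s; apply/asboolP; exact: tensor_refl. Qed.

Fact tensor_rel_sym : symmetric tensor_rel.
Proof. by move=> s t; apply/asboolP/asboolP; exact: tensor_sym. Qed.

Fact tensor_rel_trans : transitive tensor_rel.
Proof.
by move=> t s u /asboolP st /asboolP tu; apply/asboolP; exact: tensor_trans tu.
Qed.

Canonical tensor_equiv :=
  EquivRel tensor_rel tensor_rel_refl tensor_rel_sym tensor_rel_trans.

Definition tensor : Type := {eq_quot tensor_equiv}.
HB.instance Definition _ := Choice.on tensor.
HB.instance Definition _ := EqQuotient.on tensor.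

Definition tensor_of (s : seq (M * N)) : tensor := \pi_tensor s.

Lemma tensor_ofP (s t : seq (M * N)) :
  tensor_of s = tensor_of t <-> tensor_eqv s t.
Proof. by split=> [/eqmodP/asboolP//|st]; apply/eqmodP/asboolP. Qed.

(* m (x) n *)
Definition tens (m : M) (n : N) : tensor := tensor_of [:: (m, n)].

(* Independent of the representative only if [f] respects [tensor_eqv]. *)
Definition tensor_map (f : M * N -> M * N) (t : tensor) : tensor :=
  tensor_of (map f (repr t)).

Lemma tensor_mapE (f : M * N -> M * N) :
  (forall s t, tensor_eqv s t -> tensor_eqv (map f s) (map f t)) ->
  forall s, tensor_map f (tensor_of s) = tensor_of (map f s).
Proof.
move=> fP s; apply/tensor_ofP; apply: fP.
by apply/tensor_ofP; rewrite /tensor_of reprK.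
Qed.

Lemma tensor_of_surj (t : tensor) : exists s, t = tensor_of s.
Proof. by exists (repr t); rewrite /tensor_of reprK. Qed.

Definition tensor_add (t u : tensor) : tensor := tensor_of (repr t ++ repr u).
Definition tensor_opp : tensor -> tensor := tensor_map (fun p => (- p.1, p.2)).

Lemma tensor_addE s t :
  tensor_add (tensor_of s) (tensor_of t) = tensor_of (s ++ t).
Proof.
by apply/tensor_ofP; apply: tensor_cat; apply/tensor_ofP;
  rewrite /tensor_of reprK.
Qed.

Lemma ract0 b : ract bM 0 b = 0.
Proof. by apply: (@addrI _ (ract bM 0 b)); rewrite -ractDl !addr0. Qed.

Lemma tensor_eqv_opp s t : tensor_eqv s t ->
  tensor_eqv [seq (- p.1, p.2) | p <- s] [seq (- p.1, p.2) | p <- t].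
Proof.
elim=> {s t}.
- by move=> s; exact: tensor_refl.
- by move=> s t _; exact: tensor_sym.
- by move=> t s u _ st _; exact: tensor_trans.
- by move=> s s' t t' _ ss' _ tt'; rewrite !map_cat; exact: tensor_cat.
- by move=> s t; rewrite !map_cat; exact: tensor_comm.
- by move=> n /=; rewrite oppr0; exact: tensor_0l.
- by move=> m m' n /=; rewrite opprD; exact: tensor_Dl.
- by move=> m n n' /=; exact: tensor_Dr.
- move=> m b n /=; rewrite (_ : - ract bM m b = ract bM (- m) b).
    exact: tensor_bal.
  by apply: (@addrI _ (ract bM m b)); rewrite addrN -ractDl addrN ract0.
Qed.

Lemma tensor_oppE s :
  tensor_opp (tensor_of s) = tensor_of [seq (- p.1, p.2) | p <- s].
Proof. by apply: tensor_mapE; exact: tensor_eqv_opp. Qed.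

Fact tensor_addA : associative tensor_add.
Proof.
move=> t u w; have [s ->] := tensor_of_surj t; have [s' ->] := tensor_of_surj u.
by have [s'' ->] := tensor_of_surj w; rewrite !tensor_addE catA.
Qed.

Fact tensor_addC : commutative tensor_add.
Proof.
move=> t u; have [s ->] := tensor_of_surj t; have [s' ->] := tensor_of_surj u.
by rewrite !tensor_addE; apply/tensor_ofP; exact: tensor_comm.
Qed.

Fact tensor_add0 : left_id (tensor_of [::]) tensor_add.
Proof. by move=> t; have [s ->] := tensor_of_surj t; rewrite tensor_addE. Qed.

Fact tensor_addN : left_inverse (tensor_of [::]) tensor_opp tensor_add.
Proof.
move=> t; have [s ->] := tensor_of_surj t.
rewrite tensor_oppE tensor_addE; apply/tensor_ofP.
elim: s => [|[m n] s IHs] /=; first exact: tensor_refl.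
apply: (@tensor_trans ([:: (- m, n); (m, n)] ++ ([seq (- p.1, p.2) | p <- s] ++ s))).
  rewrite -[_ :: _ ++ _]/([:: (- m, n)] ++ _) -[X in tensor_eqv _ X]/([:: (- m, n)] ++ _).
  apply: tensor_cat; first exact: tensor_refl.
  rewrite -[(m, n) :: s]/([:: (m, n)] ++ s) catA.
  rewrite -[X in tensor_eqv _ X]/(([:: (m, n)] ++ _) ++ s).
  by apply: tensor_cat; [exact: tensor_comm | exact: tensor_refl].
rewrite -[[::]]/([::] ++ [::]); apply: tensor_cat => //.
apply: tensor_trans (tensor_0l n); rewrite -(addNr m).
by apply: tensor_sym; exact: tensor_Dl.
Qed.

HB.instance Definition _ := GRing.isZmodule.Build tensor
  tensor_addA tensor_addC tensor_add0 tensor_addN.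

Lemma lact0 a : lact bM a 0 = 0.
Proof.
by apply: (@addrI _ (lact bM a 0)); rewrite -lactDr !addr0.
Qed.

Lemma tensor_eqv_lact a s t : tensor_eqv s t ->
  tensor_eqv [seq (lact bM a p.1, p.2) | p <- s]
             [seq (lact bM a p.1, p.2) | p <- t].
Proof.
elim=> {s t}.
- by move=> s; exact: tensor_refl.
- by move=> s t _; exact: tensor_sym.
- by move=> t s u _ st _; exact: tensor_trans.
- by move=> s s' t t' _ ss' _ tt'; rewrite !map_cat; exact: tensor_cat.
- by move=> s t; rewrite !map_cat; exact: tensor_comm.
- by move=> n /=; rewrite lact0; exact: tensor_0l.
- by move=> m m' n /=; rewrite lactDr; exact: tensor_Dl.
- by move=> m n n' /=; exact: tensor_Dr.
- by move=> m b n /=; rewrite -lractA; exact: tensor_bal.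
Qed.

Lemma tensor_eqv_ract c s t : tensor_eqv s t ->
  tensor_eqv [seq (p.1, ract bN p.2 c) | p <- s]
             [seq (p.1, ract bN p.2 c) | p <- t].
Proof.
elim=> {s t}.
- by move=> s; exact: tensor_refl.
- by move=> s t _; exact: tensor_sym.
- by move=> t s u _ st _; exact: tensor_trans.
- by move=> s s' t t' _ ss' _ tt'; rewrite !map_cat; exact: tensor_cat.
- by move=> s t; rewrite !map_cat; exact: tensor_comm.
- by move=> n /=; exact: tensor_0l.
- by move=> m m' n /=; exact: tensor_Dl.
- by move=> m n n' /=; rewrite ractDl; exact: tensor_Dr.
- by move=> m b n /=; rewrite lractA; exact: tensor_bal.
Qed.

(* a (m (x) n) = (a m) (x) n and (m (x) n) c = m (x) (n c) *)
Definition tensor_lact (a : A) : tensor -> tensor :=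
  tensor_map (fun p => (lact bM a p.1, p.2)).
Definition tensor_ract (t : tensor) (c : C) : tensor :=
  tensor_map (fun p => (p.1, ract bN p.2 c)) t.

Lemma tensor_lactE a s :
  tensor_lact a (tensor_of s) = tensor_of [seq (lact bM a p.1, p.2) | p <- s].
Proof. by apply: tensor_mapE; exact: tensor_eqv_lact. Qed.

Lemma tensor_ractE s c :
  tensor_ract (tensor_of s) c = tensor_of [seq (p.1, ract bN p.2 c) | p <- s].
Proof.
by apply: (@tensor_mapE (fun p => (p.1, ract bN p.2 c)));
  exact: tensor_eqv_ract.
Qed.

Lemma tensor_ofD s t : tensor_of s + tensor_of t = tensor_of (s ++ t).
Proof. exact: tensor_addE. Qed.

Lemma tensor_of_cons m n s : tensor_of ((m, n) :: s) = tens m n + tensor_of s.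
Proof. by rewrite tensor_ofD. Qed.

Lemma tensor_lactD a : {morph tensor_lact a : t u / t + u}.
Proof.
move=> t u; have [s ->] := tensor_of_surj t; have [s' ->] := tensor_of_surj u.
by rewrite tensor_ofD !tensor_lactE map_cat tensor_ofD.
Qed.

Lemma tensor_ractD c : {morph tensor_ract^~ c : t u / t + u}.
Proof.
move=> t u; have [s ->] := tensor_of_surj t; have [s' ->] := tensor_of_surj u.
by rewrite tensor_ofD !tensor_ractE map_cat tensor_ofD.
Qed.

Lemma tensor_lact_tens a m n : tensor_lact a (tens m n) = tens (lact bM a m) n.
Proof. exact: tensor_lactE. Qed.

Lemma tensor_ract_tens m n c : tensor_ract (tens m n) c = tens m (ract bN n c).
Proof. exact: tensor_ractE. Qed.

Lemma tensor_additive_eq (f g : tensor -> tensor) :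
    {morph f : t u / t + u} -> {morph g : t u / t + u} ->
  (forall m n, f (tens m n) = g (tens m n)) -> f =1 g.
Proof.
move=> fD gD fg t; have [s ->] := tensor_of_surj t.
have h0 (h : tensor -> tensor) : {morph h : t u / t + u} -> h 0 = 0.
  by move=> hD; apply: (@addrI _ (h 0)); rewrite -hD !addr0.
elim: s => [|[m n] s IHs]; first by rewrite (_ : tensor_of [::] = 0) // !h0.
by rewrite tensor_of_cons fD gD fg IHs.
Qed.

Lemma tens_Dl m m' n : tens (m + m') n = tens m n + tens m' n.
Proof. by rewrite tensor_ofD; apply/tensor_ofP; exact: tensor_Dl. Qed.

Lemma tens_Dr m n n' : tens m (n + n') = tens m n + tens m n'.
Proof. by rewrite tensor_ofD; apply/tensor_ofP; exact: tensor_Dr. Qed.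

Fact tensor_lactDl a a' t :
  tensor_lact (a + a') t = tensor_lact a t + tensor_lact a' t.
Proof.
move: t; apply: tensor_additive_eq => [|t u|m n].
- exact: tensor_lactD.
- by rewrite !tensor_lactD addrACA.
- by rewrite !tensor_lact_tens lactDl tens_Dl.
Qed.

Fact tensor_lactA a a' t :
  tensor_lact (a ** a') t = tensor_lact a (tensor_lact a' t).
Proof.
move: t; apply: tensor_additive_eq => [|t u|m n].
- exact: tensor_lactD.
- by rewrite !tensor_lactD.
- by rewrite !tensor_lact_tens lactA.
Qed.

Fact tensor_ractDr t c c' :
  tensor_ract t (c + c') = tensor_ract t c + tensor_ract t c'.
Proof.
move: t; apply: tensor_additive_eq => [|t u|m n].
- exact: tensor_ractD.
- by rewrite !tensor_ractD addrACA.
- by rewrite !tensor_ract_tens ractDr tens_Dr.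
Qed.

Fact tensor_ractA t c c' :
  tensor_ract t (c ** c') = tensor_ract (tensor_ract t c) c'.
Proof.
move: t; apply: tensor_additive_eq => [|t u|m n].
- exact: tensor_ractD.
- by rewrite !tensor_ractD.
- by rewrite !tensor_ract_tens ractA.
Qed.

Fact tensor_lractA a t c :
  tensor_ract (tensor_lact a t) c = tensor_lact a (tensor_ract t c).
Proof.
move: t; apply: tensor_additive_eq => [t u|t u|m n].
- by rewrite !(tensor_lactD, tensor_ractD).
- by rewrite !(tensor_lactD, tensor_ractD).
- by rewrite !(tensor_lact_tens, tensor_ract_tens).
Qed.

Definition tensor_bimodule : bimodule A C tensor :=
  Bimodule tensor_lactDl tensor_lactD tensor_lactA
    (fun t u c => tensor_ractD c t u) tensor_ractDr tensor_ractA tensor_lractA.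

End Tensor.

Section Morita.
Context {A B : nuRingType} {M N : zmodType}.
Variables (bM : bimodule A B M) (bN : bimodule B A N).
Variables (psi : tensor bM bN -> A) (phi : tensor bN bM -> B).

Record Morita_context : Prop := MoritaContext {
  psi_hom : bimodule_hom (tensor_bimodule bM bN) (ring_bimodule A) psi;
  phi_hom : bimodule_hom (tensor_bimodule bN bM) (ring_bimodule B) phi;
  psi_phi : forall (n' : N) (m : M) (n : N),
    ract bN n' (psi (tens bM bN m n)) = lact bN (phi (tens bN bM n' m)) n;
  phi_psi : forall (m' : M) (n : N) (m : M),
    ract bM m' (phi (tens bN bM n m)) = lact bM (psi (tens bM bN m' n)) m }.

Definition surjective_Morita_context : Prop :=
  [/\ Morita_context, range psi = setT & range phi = setT].

End Morita.

(* Main.v *)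
Require Import Defs.
From HB Require Import structures.
From mathcomp Require Import all_boot all_order all_algebra zify.
From mathcomp Require Import all_classical.

Set Implicit Arguments.
Unset Strict Implicit.
Unset Printing Implicit Defensive.

Import GRing.Theory.
Local Open Scope classical_set_scope.
Local Open Scope ring_scope.

(** Write [E U W] for the span of the [t l ** tst mu] with [r l] in [U] and [r mu]
    in [W].  Since the desourcification has no sources, expanding [q_(r mu)] at a
    degree above [d mu] and [d nu] turns [tst mu ** t nu] into a sum of terms
    [t a ** tst b], so that [E U W ** E U' W'] lies in [E U W'].  With [V] the
    range of [iota0] and [T] the set of all vertices, this makes [E T V] and
    [E V T] bimodules, because the generated subalgebra is exactly [E V V]: if [l] and [mu] start in [V] and have
    the same source, then [l = iota(a) c] and [mu = iota(b) c], where [c] is the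
    only path of its degree with its range, whence [t c ** tst c = q_(r c)] and
    [t l ** tst mu = t_(iota a) ** tst_(iota b)].  Both products are surjective
    because [t l ** tst mu = (t l ** tst c) ** (t c ** tst mu)] as soon as [c] has
    the source of [l], and every vertex is the source of a path starting in [V]. *)

(** * Arithmetic of degrees and of their truncation at an extended degree *)

Section Degrees.
Context {k : nat}.
Implicit Types (m n p q : degree k) (M : xdegree k).

Lemma degD m n i : (m + n) i = (m i + n i)%N.
Proof. by rewrite ffunE. Qed.

Lemma deg0 i : (0 : degree k) i = 0%N.
Proof. by rewrite ffunE. Qed.

Lemma dsubE m n i : dsub m n i = (m i - n i)%N.
Proof. by rewrite ffunE. Qed.

Lemma degP m n : (forall i, m i = n i :> nat) <-> m = n.
Proof. by split=> [e|-> //]; apply/ffunP=> i; exact: e. Qed.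

Definition degE := (degD, deg0, dsubE).

Lemma dleP m n : reflect (forall i, (m i <= n i)%N) (dle m n).
Proof. exact: forallP. Qed.

Lemma xdleP m M :
  reflect (forall i, if M i is Some a then (m i <= a)%N : Prop else True)
          (xdle m M).
Proof.
apply: (iffP forallP) => H i; have := H i; by case: (M i).
Qed.

Lemma meetxE m M i :
  meetx m M i = if M i is Some a then minn (m i) a else m i.
Proof. by rewrite ffunE. Qed.

Lemma dle_trans n m p : dle m n -> dle n p -> dle m p.
Proof. by move=> /dleP mn /dleP np; apply/dleP=> i; have := mn i; have := np i; lia. Qed.

Lemma dle_addr m n : dle m (m + n).
Proof. by apply/dleP=> i; rewrite !degE; lia. Qed.

Lemma dsubK m n : dle m n -> m + dsub n m = n.
Proof. by move=> /dleP mn; apply/degP=> i; have := mn i; rewrite !degE; lia. Qed.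

Lemma dsub_addl m n : dsub (m + n) m = n.
Proof. by apply/degP=> i; rewrite !degE; lia. Qed.

Lemma dsubn0 m : dsub m 0 = m.
Proof. by apply/degP=> i; rewrite !degE; lia. Qed.

Lemma dsubnn m : dsub m m = 0.
Proof. by apply/degP=> i; rewrite !degE; lia. Qed.

Lemma meetx_le m M : dle (meetx m M) m.
Proof. by apply/dleP=> i; rewrite meetxE; case: (M i) => [a|]; lia. Qed.

Lemma meetx_xdle m M : xdle (meetx m M) M.
Proof. by apply/xdleP=> i; rewrite meetxE; case: (M i) => [a|]; lia. Qed.

Lemma meetx_mono m n M : dle m n -> dle (meetx m M) (meetx n M).
Proof.
move=> /dleP mn; apply/dleP=> i; have := mn i; rewrite !meetxE.
by case: (M i) => [a|]; lia.
Qed.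

Lemma xdle_trans m n M : dle m n -> xdle n M -> xdle m M.
Proof.
move=> /dleP mn /xdleP nM; apply/xdleP=> i; have := mn i; have := nM i.
by case: (M i) => [a|//]; lia.
Qed.

Lemma meetx_id m M : xdle m M -> meetx m M = m.
Proof.
move=> /xdleP mM; apply/degP=> i; have := mM i; rewrite meetxE.
by case: (M i) => [a|//]; lia.
Qed.

Lemma xdle0 M : xdle 0 M.
Proof. by apply/xdleP=> i; rewrite deg0; case: (M i). Qed.

End Degrees.

(** * Segments of paths *)

Section Factor.
Context {k : nat} {L : kgraph k}.
Implicit Types (l a b c : kpath L) (m n p q : degree k).
Let ax := kgraphP L.

(** Factorisation as a total function: the default [(l, l)] is returned only when [n] is not below
    [deg l]. The degree of the second factor is omitted, being determined by the other two. *)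
Definition cut l n : kpath L * kpath L := xget (l, l)
  [set ab | [/\ deg ab.1 = n, src ab.1 = rng ab.2 & l = kcomp ab.1 ab.2]].
Definition prefix l n := (cut l n).1.
Definition suffix l n := (cut l n).2.

Lemma cutP l n : dle n (deg l) ->
  [/\ deg (prefix l n) = n, src (prefix l n) = rng (suffix l n)
    & l = kcomp (prefix l n) (suffix l n)].
Proof.
move=> nl; have := factorisation ax (esym (dsubK nl)).
case=> ab [[h1 h2 h3 h4] _].
by have [] := @xgetPex _ (l, l) _ (ex_intro (fun ab : kpath L * kpath L =>
  [/\ deg ab.1 = n, src ab.1 = rng ab.2 & l = kcomp ab.1 ab.2]) ab
  (And3 h1 h3 h4)).
Qed.

(** By additivity the second factors also have equal degrees, so both pairs factor one path at the
    same degrees. This is the form in which unique factorisation is used below. *)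
Lemma kcomp_inj a b a' b' : src a = rng b -> src a' = rng b' -> deg a = deg a' ->
  kcomp a b = kcomp a' b' -> a = a' /\ b = b'.
Proof.
move=> ab ab' dd e.
have db : deg b = deg b'.
  have := congr1 deg e; rewrite !(deg_comp ax) // dd => /degP h.
  by apply/degP=> i; have := h i; rewrite !degE; lia.
have [[x y] [_ u]] := factorisation ax (deg_comp ax ab).
have [ex ey] : (x, y) = (a, b) by apply: u; split.
by have [<- <-] : (x, y) = (a', b') by apply: u; split.
Qed.

Lemma prefix_deg l n : dle n (deg l) -> deg (prefix l n) = n.
Proof. by case/cutP. Qed.

Lemma src_prefix l n : dle n (deg l) -> src (prefix l n) = rng (suffix l n).
Proof. by case/cutP. Qed.

Lemma prefix_suffix l n : dle n (deg l) -> kcomp (prefix l n) (suffix l n) = l.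
Proof. by case/cutP. Qed.

Lemma suffix_deg l n : dle n (deg l) -> deg (suffix l n) = dsub (deg l) n.
Proof.
move=> nl; have := deg_comp ax (src_prefix nl).
by rewrite prefix_suffix // prefix_deg // => ->; rewrite dsub_addl.
Qed.

Lemma rng_prefix l n : dle n (deg l) -> rng (prefix l n) = rng l.
Proof.
by move=> nl; have := rng_comp ax (src_prefix nl); rewrite prefix_suffix.
Qed.

Lemma src_suffix l n : dle n (deg l) -> src (suffix l n) = src l.
Proof.
by move=> nl; have := src_comp ax (src_prefix nl); rewrite prefix_suffix.
Qed.

Lemma cut_kcomp a b : src a = rng b ->
  prefix (kcomp a b) (deg a) = a /\ suffix (kcomp a b) (deg a) = b.
Proof.
move=> ab; have le : dle (deg a) (deg (kcomp a b)).
  by rewrite (deg_comp ax ab) dle_addr.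
by apply: kcomp_inj; rewrite ?prefix_suffix ?src_prefix ?prefix_deg.
Qed.

Lemma suffix_all l : suffix l (deg l) = idp (src l).
Proof.
have e := rng_id ax (src l).
by have := (cut_kcomp (esym e)).2; rewrite (comp_idr ax).
Qed.

Lemma prefix_all l : prefix l (deg l) = l.
Proof.
have e := rng_id ax (src l).
by have := (cut_kcomp (esym e)).1; rewrite (comp_idr ax).
Qed.

Lemma prefix_kcomp a b n : src a = rng b -> dle n (deg a) ->
  prefix (kcomp a b) n = prefix a n.
Proof.
move=> ab na; rewrite -{1}(prefix_suffix na) -(Defs.compA ax) ?src_prefix ?src_suffix //.
have := @cut_kcomp (prefix a n) (kcomp (suffix a n) b).
by rewrite prefix_deg // (rng_comp ax) ?src_suffix // src_prefix //; case.
Qed.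

Lemma prefix_prefix l m n : dle m n -> dle n (deg l) ->
  prefix (prefix l n) m = prefix l m.
Proof.
move=> mn nl; rewrite -[in RHS](prefix_suffix nl) prefix_kcomp ?src_prefix //.
by rewrite prefix_deg.
Qed.

(** Cancel the initial segment of degree [m] from two factorisations of [l]. This is the
    functoriality of the limit path built below. *)
Lemma suffix_comp l m n : dle m n -> dle n (deg l) ->
  kcomp (suffix (prefix l n) m) (suffix l n) = suffix l m.
Proof.
move=> mn nl; have mp : dle m (deg (prefix l n)) by rewrite prefix_deg.
have e : kcomp (prefix l m) (kcomp (suffix (prefix l n) m) (suffix l n)) = l.
  by rewrite -(prefix_prefix mn nl) (Defs.compA ax) ?src_suffix ?src_prefix
    ?prefix_suffix ?src_prefix.
have mlt := dle_trans mn nl.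
have r : src (suffix (prefix l n) m) = rng (suffix l n) by rewrite src_suffix ?src_prefix.
have [] // := @kcomp_inj (prefix l m) (kcomp (suffix (prefix l n) m) (suffix l n))
  (prefix l m) (suffix l m); rewrite ?e ?prefix_suffix ?src_prefix //.
by rewrite (rng_comp ax) // -!src_prefix // prefix_prefix.
Qed.

(** The path [l] factors both as [l] followed by an identity and as an identity followed by [l],
    with first factors of degree 0 in both cases. *)
Lemma deg0_id l : deg l = 0 -> l = idp (rng l).
Proof.
move=> d; have [] := @kcomp_inj l (idp (src l)) (idp (rng l)) l.
- by rewrite (rng_id ax).
- by rewrite (src_id ax).
- by rewrite d (deg_id ax).
- by rewrite (comp_idl ax) (comp_idr ax).
by move=> ->; rewrite (rng_id ax).
Qed.

End Factor.

(** * Existence of boundary paths *)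

Section BoundaryExistence.
Context {k : nat} (k_gt0 : (0 < k)%N) {L : kgraph k}.
Hypothesis Llc : locally_convex L.
Implicit Types (l e : kpath L) (n p q : degree k) (v : obj L).
Let ax := kgraphP L.

Lemma unitdE (i j : 'I_k) : unitd i j = (j == i) :> nat.
Proof. by rewrite ffunE. Qed.

(** Induction on the total degree: local convexity carries an edge of direction [i] across the first
    edge of [l], whose direction [j] differs from [i] as [deg l i = 0]; the induction hypothesis
    carries it along the rest. *)
Lemma edge_transport l (i : 'I_k) : deg l i = 0%N ->
  paths_from (rng l) (unitd i) !=set0 -> paths_from (src l) (unitd i) !=set0.
Proof.
have [s] := ubnP (\sum_j deg l j)%N; elim: s l => // s IHs l ls li ve.
have [l0|[j lj]] : deg l = 0 \/ exists j, (0 < deg l j)%N.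
- have [/existsP[j lj]|/existsPn h] := boolP [exists j, (0 < deg l j)%N].
    by right; exists j.
  by left; apply/degP=> j; have := h j; rewrite deg0; lia.
- by rewrite (deg0_id l0) (src_id ax).
have ij : j != i by apply/eqP=> ij; rewrite ij li in lj.
have jl : dle (unitd j) (deg l).
  by apply/dleP=> a; rewrite unitdE; case: eqP => [->|].
rewrite -(src_suffix jl); apply: IHs.
- rewrite suffix_deg //; move: ls.
  rewrite (bigD1 j) //= [X in _ -> (X < _)%N](bigD1 j) //= dsubE unitdE eqxx subn1.
  rewrite ltnS => ls; apply: leq_trans ls; rewrite -addSn leq_add //; first by lia.
  by apply: leq_sum => a _; rewrite dsubE leq_subr.
- by rewrite suffix_deg // dsubE li.
- rewrite -src_prefix //; case: ve => e [re de].
  have [|//] := @Llc (rng l) j i (prefix l (unitd j)) e ij _ (conj re de).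
  by split; [exact: rng_prefix | exact: prefix_deg].
Qed.

(** * The limit of an increasing sequence of paths *)

Section Limit.
Variables (mu : nat -> kpath L).
Hypothesis mu_ext : forall j, exists2 e, src (mu j) = rng e & mu j.+1 = kcomp (mu j) e.

Lemma mu_stable i j : (i <= j)%N -> dle (deg (mu i)) (deg (mu j)) /\
  prefix (mu j) (deg (mu i)) = mu i.
Proof.
elim: j => [|j IHj]; first by rewrite leqn0 => /eqP->; rewrite prefix_all dle_refl.
rewrite leq_eqVlt => /orP[/eqP->|]; first by rewrite prefix_all dle_refl.
rewrite ltnS => /IHj[le pre]; have [e je ->] := mu_ext j; split.
  by rewrite (deg_comp ax) //; apply: dle_trans le (dle_addr _ _).
by rewrite prefix_kcomp.
Qed.

Let bounded i a := (forall j, deg (mu j) i <= a)%N /\ exists j, deg (mu j) i = a.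

Definition sup_deg : xdegree k :=
  [ffun i => if pselect (exists a, bounded i a) is left ex
             then Some (xget 0%N (bounded i)) else None].

(** If coordinate [i] has no attained bound, every value that it reaches is exceeded later, so by
    induction it passes every [a]. *)
Lemma sup_degP i : if sup_deg i is Some a then bounded i a
  else forall a, exists j, (a <= deg (mu j) i)%N.
Proof.
rewrite ffunE; case: pselect => [ex|nex].
  by case: ex => a ha; apply: (@xgetPex _ 0%N (bounded i)); exists a.
elim=> [|a [j ja]]; first by exists 0%N.
have [n1|n1] := pselect (exists j, (a < deg (mu j) i)%N); first by [].
exfalso; apply: nex; exists a; have h b : (deg (mu b) i <= a)%N.
  by rewrite leqNgt; apply/negP=> ab; apply: n1; exists b.
by split=> //; exists j; have := h j; lia.
Qed.

Lemma le_sup_deg j : xdle (deg (mu j)) sup_deg.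
Proof. by apply/xdleP=> i; have := sup_degP i; case: (sup_deg i) => // a []. Qed.

(** Each coordinate of [p] is passed at some stage, and the largest of these stages serves for all,
    since degrees increase. *)
Lemma mu_reaches p : xdle p sup_deg -> exists j, dle p (deg (mu j)).
Proof.
move=> /xdleP ps; have h i : exists j, (p i <= deg (mu j) i)%N.
  have := sup_degP i; have := ps i; case: (sup_deg i) => [a|_]; last exact.
  by move=> pa [_ [j ja]]; exists j; rewrite ja.
have [J HJ] := choice h; exists (\max_i J i)%N; apply/dleP=> i.
apply: leq_trans (HJ i) _.
by have [/dleP le _] := mu_stable (leq_bigmax (F := J) i); apply: le.
Qed.

Definition reach p : nat := xget 0%N [set j | dle p (deg (mu j))].

Lemma reachP p : xdle p sup_deg -> dle p (deg (mu (reach p))).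
Proof.
move=> /mu_reaches[j pj].
by apply: (@xgetPex _ 0%N [set j | dle p (deg (mu j))]); exists j.
Qed.

(** The segment x(0,p) of the limit x, cut from one stage that reaches [p]; by [initialE] any such
    stage gives the same path. *)
Definition initial p : kpath L := prefix (mu (reach p)) p.

Lemma initialE p j : dle p (deg (mu j)) -> initial p = prefix (mu j) p.
Proof.
move=> pj; have pr := reachP (xdle_trans pj (le_sup_deg j)).
rewrite /initial; have [le|/ltnW le] := leqP (reach p) j;
  have [h e] := mu_stable le.
- by rewrite -[in LHS]e prefix_prefix.
- by rewrite -[in RHS]e prefix_prefix.
Qed.

Lemma initial_deg p : xdle p sup_deg -> deg (initial p) = p.
Proof. by move=> /reachP; apply: prefix_deg. Qed.

Lemma initial_initial p q : dle p q -> xdle q sup_deg ->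
  prefix (initial q) p = initial p.
Proof.
move=> pq /mu_reaches[j qj].
by rewrite (initialE qj) (initialE (dle_trans pq qj)) prefix_prefix.
Qed.

Definition limit_map : omega_map L :=
  OmegaMap sup_deg (fun p => src (initial p)) (fun p q => suffix (initial q) p).

Lemma limit_functor : omega_functor limit_map.
Proof.
split=> /= [p q pq qs|p q pq qs|p q pq qs|p ps|p q l pq ql ls].
- by rewrite -src_prefix ?initial_initial // initial_deg.
- by rewrite src_suffix ?initial_deg.
- by rewrite suffix_deg ?initial_deg.
- by rewrite -[X in suffix _ X](initial_deg ps) suffix_all.
- by rewrite -(initial_initial ql ls) suffix_comp // initial_deg.
Qed.

(** Suppose that an edge of direction [i] leaves x(p), where [p i] is already the maximum. From a
    stage reaching [p] onwards nothing is added in direction [i], so [edge_transport] moves the edge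
    to the end of a stage at which direction [i] has its turn. That stage then grows past the
    maximum. *)
Lemma limit_boundary :
  (forall i j, exists2 j', (j <= j')%N &
     paths_from (src (mu j')) (unitd i) !=set0 -> (deg (mu j') i < deg (mu j'.+1) i)%N) ->
  is_boundary_path limit_map.
Proof.
move=> maximal; split; first exact: limit_functor.
move=> p i ps pi; apply/eqP/contraT => /set0P ne.
have [j pj] := mu_reaches ps; have [j' jj' grow] := maximal i j.
have [le _] := mu_stable jj'; have pj' := dle_trans pj le.
have := sup_degP i; rewrite -pi => -[bd _].
have d0 : deg (mu j') i = p i.
  by apply/eqP; rewrite eqn_leq bd; move/dleP: pj'; apply.
have : (deg (mu j') i < deg (mu j'.+1) i)%N; last by have := bd j'.+1; rewrite d0; lia.
apply: grow; rewrite -(src_suffix pj'); apply: edge_transport.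
  by rewrite suffix_deg // dsubE d0 subnn.
by rewrite -src_prefix // -initialE.
Qed.

End Limit.

(** * A boundary path through a given path, built by greedy extension *)

Definition extend_edge (i : 'I_k) l : kpath L :=
  if pselect (paths_from (src l) (unitd i) !=set0) is left _
  then kcomp l (xget l (paths_from (src l) (unitd i))) else l.

(* Directions are tried cyclically, so each of them comes up infinitely often. *)
Fixpoint greedy l j : kpath L :=
  if j is j'.+1
  then extend_edge (Ordinal (ltn_pmod j' k_gt0)) (greedy l j') else l.

Lemma greedy_ext l j : exists2 e, src (greedy l j) = rng e &
  greedy l j.+1 = kcomp (greedy l j) e.
Proof.
rewrite /= /extend_edge; case: pselect => [ne|_].
  set P := paths_from _ _ in ne *.
  have [r _] : P (xget (greedy l j) P) by case: ne => e Pe; apply: xgetPex; exists e.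
  by exists (xget (greedy l j) P).
by exists (idp (src (greedy l j))); rewrite ?(rng_id ax) ?(comp_idr ax).
Qed.

Lemma boundary_path_through l : exists x : boundary_path L,
  xdle (deg l) (pdeg x) /\ ppath x 0 (deg l) = l.
Proof.
have bd : is_boundary_path (limit_map (greedy l)).
  apply: limit_boundary => [j|i j]; first exact: greedy_ext.
  (* This stage comes no earlier than [j], and direction [i] is tried there because [i] is its
     residue modulo [k]. *)
  exists (j * k + i)%N; first by nia.
  set a := greedy l (j * k + i).
  have -> : greedy l (j * k + i).+1 = extend_edge i a.
    by rewrite /=; congr extend_edge; apply: val_inj; rewrite /= modnMDl modn_small.
  rewrite /extend_edge; case: pselect => [ne _|nh h]; last by [].
  set P := paths_from _ _ in ne *.
  have [r d] : P (xget a P) by case: ne => e Pe; apply: xgetPex; exists e.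
  by rewrite (deg_comp ax) // degD d unitdE eqxx addn1.
exists (BoundaryPath bd); split; first exact: (le_sup_deg (greedy l) 0).
have g : forall j, exists2 e, src (greedy l j) = rng e &
  greedy l j.+1 = kcomp (greedy l j) e by exact: greedy_ext.
rewrite /= (initialE g (dle_refl (deg (greedy l 0)))) /= prefix_all.
(* What remains is the suffix of [l] at 0, which is [l] because [l] is an identity followed by
   [l]. *)
have := cut_kcomp (src_id ax (rng l)); rewrite (deg_id ax) (comp_idl ax).
by case.
Qed.

Lemma boundary_path_exists v : exists x : boundary_path L, pobj x 0 = v.
Proof.
have [x [vx e]] := boundary_path_through (idp v); exists x.
have [F _] := boundary_pathP x.
by rewrite -(rng_ppath F (dle0 _) vx) e (rng_id ax).
Qed.

End BoundaryExistence.

(** * The desourcification *)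

Section Desource.
Context {k : nat} {L : kgraph k}.
Implicit Types (x y z : boundary_path L) (m n p q : degree k) (c f g h : ds_path L).

Local Notation "m /\_ x" := (meetx m (pdeg (boundary_path_map x))) (at level 40).

Lemma meetx_seg x m n : dle m n ->
  [/\ rng (ppath x (m /\_ x) (n /\_ x)) = pobj x (m /\_ x),
      src (ppath x (m /\_ x) (n /\_ x)) = pobj x (n /\_ x)
    & deg (ppath x (m /\_ x) (n /\_ x)) = dsub (n /\_ x) (m /\_ x)].
Proof.
move=> mn; have [F _] := boundary_pathP x.
have le := meetx_mono (pdeg x) mn; have bd := meetx_xdle n (pdeg x).
by rewrite (rng_ppath F) ?(src_ppath F) ?(deg_ppath F).
Qed.

Lemma cls_objP x y m p : cls_obj x m = cls_obj y p <->
  pobj x (m /\_ x) = pobj y (p /\_ y) /\ dsub m (m /\_ x) = dsub p (p /\_ y).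
Proof.
split=> [/eqmodP/andP[/eqP-> /eqP->] //|[e1 e2]].
by apply/eqmodP; rewrite /= /obj_rel e1 e2 !eqxx.
Qed.

Lemma cls_pathP x y m n p q (mn : dle m n) (pq : dle p q) :
  cls_path x mn = cls_path y pq <->
  [/\ ppath x (m /\_ x) (n /\_ x) = ppath y (p /\_ y) (q /\_ y),
      dsub m (m /\_ x) = dsub p (p /\_ y) & dsub n m = dsub q p].
Proof.
split=> [/eqmodP/and3P[/eqP e1 /eqP e2 /eqP e3] //|[e1 e2 e3]].
by apply/eqmodP/and3P; split; apply/eqP.
Qed.

Lemma ds_pathE c : c = cls_path (pre_base (ds_rep c)) (valP (ds_rep c)).
Proof.
rewrite /cls_path -[LHS]reprK; congr (\pi_ _)%qT; rewrite /ds_rep.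
by apply: val_inj; rewrite /= /pre_base -!surjective_pairing.
Qed.

Lemma cls_path_surj c : exists x m n (mn : dle m n), c = cls_path x mn.
Proof. by eexists _, _, _, _; exact: ds_pathE. Qed.

Lemma cls_obj_surj (v : ds_obj L) : exists x m, v = cls_obj x m.
Proof.
exists (repr v).1, (repr v).2; rewrite /cls_obj -[LHS]reprK; congr (\pi_ _)%qT.
by case: (repr v).
Qed.

(** Isolates the representative chosen by [repr]; the next lemmas show that range, source and degree
    can be read off any other one. *)
Lemma ds_rep_cls c : exists (y : boundary_path L) (p q : degree k) (pq : dle p q),
  [/\ c = cls_path y pq, ds_rng c = cls_obj y p, ds_src c = cls_obj y q
    & ds_deg c = dsub q p].
Proof.
exists (pre_base (ds_rep c)), (pre_start (ds_rep c)), (pre_end (ds_rep c)).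
by exists (valP (ds_rep c)); split=> //; exact: ds_pathE.
Qed.

Lemma ds_rng_cls x m n (mn : dle m n) : ds_rng (cls_path x mn) = cls_obj x m.
Proof.
have [y [p [q [pq [/cls_pathP[e1 e2 _] -> _ _]]]]] := ds_rep_cls (cls_path x mn).
apply/cls_objP; have [<- _ _] := meetx_seg x mn; have [<- _ _] := meetx_seg y pq.
by split; [rewrite e1 | exact: esym].
Qed.

Lemma ds_src_cls x m n (mn : dle m n) : ds_src (cls_path x mn) = cls_obj x n.
Proof.
have [y [p [q [pq [/cls_pathP[e1 e2 e3] _ -> _]]]]] := ds_rep_cls (cls_path x mn).
apply/cls_objP.
have [_ <- d1] := meetx_seg x mn; have [_ <- d2] := meetx_seg y pq.
split; first by rewrite e1.
(* The excess of [n] over d(x) is determined by the excess of [m], by [n - m] and by the degree of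
   the segment, all of which the two representatives share. *)
apply/degP=> i; have /degP/(_ i) := congr1 deg e1; rewrite d1 d2.
have /degP/(_ i) := e2; have /degP/(_ i) := e3; rewrite !dsubE.
have /dleP/(_ i) := mn; have /dleP/(_ i) := pq.
have /dleP/(_ i) := meetx_le m (pdeg x); have /dleP/(_ i) := meetx_le n (pdeg x).
have /dleP/(_ i) := meetx_le p (pdeg y); have /dleP/(_ i) := meetx_le q (pdeg y).
have /dleP/(_ i) := meetx_mono (pdeg x) mn; have /dleP/(_ i) := meetx_mono (pdeg y) pq.
by lia.
Qed.

Lemma ds_deg_cls x m n (mn : dle m n) : ds_deg (cls_path x mn) = dsub n m.
Proof.
by have [y [p [q [pq [/cls_pathP[_ _ ->] _ _ ->]]]]] := ds_rep_cls (cls_path x mn).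
Qed.

Lemma ds_id_cls x m : ds_id (cls_obj x m) = cls_path x (dle_refl m).
Proof.
rewrite /ds_id; have := reprK (cls_obj x m).
move: (repr _) => [y p] /cls_objP[e1 e2]; apply/cls_pathP; split=> //=.
  have [F _] := boundary_pathP x; have [G _] := boundary_pathP y.
  by rewrite (ppath_id F) ?(ppath_id G) ?meetx_xdle // e1.
by rewrite !dsubnn.
Qed.

(** Evaluates the composition formula. The equality of the classes makes the excess of [n] over d(x)
    equal to that of [p] over d(y). Hence, where [n] exceeds d(x), also [p] exceeds d(y) and d(z)
    agrees with d(x); in the other coordinates d(z) is at least [n]. *)
Lemma concat_cls x y z m n p q : dle m n -> dle p q ->
  cls_obj x n = cls_obj y p ->
  is_concat (ppath x 0 (n /\_ x)) (shift (p /\_ y) y) z ->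
  [/\ m /\_ z = m /\_ x,
      ppath z (m /\_ z) (n /\_ x) = ppath x (m /\_ x) (n /\_ x)
    & ppath z (m /\_ z) (dsub (n + q) p /\_ z) =
      kcomp (ppath x (m /\_ x) (n /\_ x)) (ppath y (p /\_ y) (q /\_ y))].
Proof.
move=> mn pq /cls_objP[e7 e8] [dz z0 [_ _ zy]].
have [F _] := boundary_pathP x; have [Fz _] := boundary_pathP z.
have da : deg (ppath x 0 (n /\_ x)) = n /\_ x.
  by rewrite (deg_ppath F) ?dle0 ?meetx_xdle // dsubn0.
rewrite da in dz z0 zy.
set a := n /\_ x in e7 e8 da dz z0 zy *.
set c := p /\_ y in e7 e8 dz zy *.
have bz : m /\_ z = m /\_ x.
  apply/degP=> i; have /degP/(_ i) := e8; have /dleP/(_ i) := mn.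
  rewrite !dsubE !meetxE dz !ffunE /=.
  by case: (pdeg x i) => [dx|]; case: (pdeg y i) => [dy|] /=; lia.
have qz : dsub (n + q) p /\_ z = a + dsub (q /\_ y) c.
  apply/degP=> i; have /degP/(_ i) := e8; have /dleP/(_ i) := pq.
  rewrite !degE !meetxE dz !ffunE /=.
  by case: (pdeg x i) => [dx|]; case: (pdeg y i) => [dy|] /=; lia.
have cq : dle c (q /\_ y) by apply: meetx_mono.
have cq' : c + dsub (q /\_ y) c = q /\_ y by apply: dsubK.
have ba : dle (m /\_ x) a by apply: meetx_mono.
have az : xdle a (pdeg z).
  by apply/xdleP=> i; rewrite dz !ffunE; case: (pdeg y i) => //= dy; lia.
have qzd : xdle (a + dsub (q /\_ y) c) (pdeg z) by rewrite -qz meetx_xdle.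
have zb : ppath z (m /\_ x) a = ppath x (m /\_ x) a.
  (* Both sides are the common initial segment of [z] and [x] up to [a], cut at the same degree;
     unique factorisation compares the second factors. *)
  have e : kcomp (ppath z 0 (m /\_ x)) (ppath z (m /\_ x) a) =
           kcomp (ppath x 0 (m /\_ x)) (ppath x (m /\_ x) a).
    by rewrite (ppath_comp Fz) ?dle0 // (ppath_comp F) ?dle0 ?meetx_xdle.
  have bz' := xdle_trans ba az; have bx' := meetx_xdle m (pdeg x).
  have ax' := meetx_xdle n (pdeg x).
  have [] // := kcomp_inj _ _ _ e.
  - by rewrite (src_ppath Fz) ?dle0 // (rng_ppath Fz).
  - by rewrite (src_ppath F) ?dle0 // (rng_ppath F).
  - by rewrite (deg_ppath Fz) ?dle0 // (deg_ppath F) ?dle0.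
have zc : ppath z a (a + dsub (q /\_ y) c) = ppath y c (q /\_ y).
  rewrite -cq' -[X in ppath z X]addr0 -[X in ppath y X]addr0 dsub_addl.
  apply: (zy 0 _ (dle0 _)); apply/xdleP=> i; have /xdleP/(_ i) := qzd.
  by rewrite /= degD [xsub _ _ _]ffunE; case: (pdeg z i) => //= d; lia.
rewrite bz qz; split=> //.
by rewrite -(ppath_comp Fz ba (dle_addr _ _)) // zb zc.
Qed.

Lemma ds_comp_rel_cls x m l n (ml : dle m l) (ln : dle l n) h :
  ds_comp_rel (cls_path x ml) (cls_path x ln) h ->
  h = cls_path x (dle_trans ml ln).
Proof.
case=> x' [y [z [m' [l' [p [q [ml' [pq [mq [/cls_pathP[e1 e2 e3]]]]]]]]]]].
move=> /cls_pathP[e4 e5 e6] xy cz ->; have [F _] := boundary_pathP x.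
have [bz _ zc] := concat_cls ml' pq xy cz.
apply/cls_pathP; rewrite zc bz -e1 -e4; split=> //.
- by rewrite (ppath_comp F) ?meetx_mono ?meetx_xdle.
- apply/degP=> i; have /degP/(_ i) := e3; have /degP/(_ i) := e6.
  have /dleP/(_ i) := ml; have /dleP/(_ i) := ln.
  have /dleP/(_ i) := ml'; have /dleP/(_ i) := pq; rewrite !degE.
  by lia.
Qed.

(** Composition of consecutive segments of one boundary path, the case that all factorisations below
    reduce to. Here [x] itself serves as the concatenated path. *)
Lemma ds_comp_cls x m l n (ml : dle m l) (ln : dle l n) :
  ds_comp (cls_path x ml) (cls_path x ln) = cls_path x (dle_trans ml ln).
Proof.
apply: ds_comp_rel_cls; have [F _] := boundary_pathP x.
have e : dsub (l + n) l = n by rewrite dsub_addl.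
have mn : dle m (dsub (l + n) l) by rewrite e (dle_trans ml ln).
apply: (@xgetPex _ _ (ds_comp_rel (cls_path x ml) (cls_path x ln))).
exists (cls_path x mn), x, x, x, m, l, l, n, ml, ln, mn; split=> //.
have d : deg (ppath x 0 (l /\_ x)) = l /\_ x.
  by rewrite (deg_ppath F) ?dle0 ?meetx_xdle // dsubn0.
split; rewrite ?d //; apply/ffunP=> i; rewrite !ffunE.
by case: (pdeg x i) => //= dx; congr Some; lia.
Qed.

Lemma ds_rng_comp f g : ds_rng (ds_comp f g) = ds_rng f.
Proof.
have [ex|nex] := pselect (exists h, ds_comp_rel f g h); last first.
  (* Without a composite, [ds_comp f g] takes its default value [f]. *)
  by rewrite /ds_comp xgetPN // => h hP; apply: nex; exists h.
have := xgetPex f ex; rewrite -/(ds_comp f g).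
case=> x [y [z [m [n [p [q [mn [pq [mq [-> _ xy cz ->]]]]]]]]]].
have [bz zb _] := concat_cls mn pq xy cz; rewrite !ds_rng_cls.
apply/cls_objP; rewrite bz; split=> //.
have [F _] := boundary_pathP x; have [Fz _] := boundary_pathP z.
have [<- _ _] := meetx_seg x mn; rewrite -zb bz (rng_ppath Fz) ?meetx_mono //.
case: cz => -> _ _; apply/xdleP=> i.
by rewrite (deg_ppath F) ?dle0 ?meetx_xdle // dsubn0 ffunE; case: (xsub _ _ i) => //= d; lia.
Qed.

Lemma shift_boundary x n : xdle n (pdeg x) -> is_boundary_path (shift n x).
Proof.
move=> nx; have [F bd] := boundary_pathP x.
have le p : xdle p (pdeg (shift n x)) -> xdle (n + p) (pdeg x).
  move=> /xdleP px; apply/xdleP=> i; have := px i; move/xdleP/(_ i): nx.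
  by rewrite /= ffunE degD; case: (pdeg x i) => //= d; lia.
have mono p q : dle p q -> dle (n + p) (n + q).
  by move=> /dleP pq; apply/dleP=> i; rewrite !degD leq_add2l.
split; first split=> /=
  [p q pq /le qx|p q pq /le qx|p q pq /le qx|p /le px|p q l pq ql /le lx].
- by rewrite (rng_ppath F) ?mono.
- by rewrite (src_ppath F) ?mono.
- rewrite (deg_ppath F) ?mono //; apply/degP=> i; rewrite !degE; lia.
- by rewrite (ppath_id F).
- by rewrite (ppath_comp F) ?mono.
move=> p i /le px pi; apply: bd => //; move: pi => /=; rewrite ffunE degD.
move/xdleP/(_ i): nx; case: (pdeg x i) => //= d nd [e]; congr Some; lia.
Qed.

Lemma is_concat_shift x n (nx : xdle n (pdeg x)) :
  is_concat (ppath x 0 n) (BoundaryPath (shift_boundary nx)) x.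
Proof.
have [F _] := boundary_pathP x.
have d : deg (ppath x 0 n) = n by rewrite (deg_ppath F) ?dle0 // dsubn0.
split; rewrite d //=; apply/ffunP=> i; rewrite !ffunE.
move/xdleP/(_ i): nx; case: (pdeg x i) => //= a na; congr Some; lia.
Qed.

(** Forgetting the part of [x] before [m] rebases the path at 0; this is possible when [m] does not
    exceed d(x). *)
Lemma cls_path_shift x m n (mn : dle m n) (mx : xdle m (pdeg x)) :
  cls_path x mn = cls_path (BoundaryPath (shift_boundary mx)) (dle0 (dsub n m)).
Proof.
apply/cls_pathP => /=.
have m0 : m /\_ x = m by apply: meetx_id.
have z0 M : meetx 0 M = 0 :> degree k by rewrite meetx_id ?xdle0.
rewrite m0 z0 !dsubnn addr0 dsubn0; split=> //; congr (ppath x m _).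
apply/degP=> i; move/xdleP/(_ i): mx; move/dleP/(_ i): mn.
rewrite degD !meetxE dsubE !ffunE; case: (pdeg x i) => /= [a|]; lia.
Qed.

(** If [x] went beyond [m] in a direction [i] in which [n] exceeds [m], its segment from [m] to
    [m + unitd i] would be an edge leaving x(m). *)
Lemma meetx_sink x m n : xdle m (pdeg x) -> dle m n ->
  (forall i, (m i < n i)%N -> paths_from (pobj x m) (unitd i) = set0) ->
  n /\_ x = m.
Proof.
move=> mx mn sink; have [F _] := boundary_pathP x; apply/degP=> i.
move/dleP/(_ i): (mn); rewrite meetxE leq_eqVlt => /orP[/eqP <-|mni].
  by move/xdleP/(_ i): mx; case: (pdeg x i) => [a|//]; lia.
have : ~ xdle (m + unitd i) (pdeg x).
  move=> mex; have : paths_from (pobj x m) (unitd i) (ppath x m (m + unitd i)).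
    by rewrite /paths_from /= (rng_ppath F) ?(deg_ppath F) ?dsub_addl ?dle_addr.
  by rewrite sink.
case E: (pdeg x i) => [a|] ne.
  move/xdleP/(_ i): (mx); rewrite E => ma.
  have [am|am] := leqP a (m i); first by lia.
  exfalso; apply: ne; apply/xdleP=> j; rewrite degD unitdE.
  move/xdleP/(_ j): mx; have [-> |] := eqVneq j i; first by rewrite E; lia.
  by rewrite addn0.
exfalso; apply: ne; apply/xdleP=> j; rewrite degD unitdE.
move/xdleP/(_ j): mx; have [-> |] := eqVneq j i; first by rewrite E.
by rewrite addn0.
Qed.

(* The vertex [x(n /\ d(x))] emits no edge of [L] in the directions in which [n]
   exceeds [d(x)], so that nothing can branch off there. *)
Lemma tail_uniq x n c : ds_rng c = cls_obj x (n /\_ x) ->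
  ds_deg c = dsub n (n /\_ x) -> c = cls_path x (meetx_le n (pdeg x)).
Proof.
have [y [p [q [pq ->]]]] := cls_path_surj c; rewrite ds_rng_cls ds_deg_cls.
have nn : (n /\_ x) /\_ x = n /\_ x by rewrite meetx_id ?meetx_xdle.
move=> /cls_objP; rewrite nn dsubnn => -[e1 e2] e3.
have py : p /\_ y = p.
  apply/degP=> i; move/degP/(_ i): e2; rewrite degE deg0.
  by move/dleP/(_ i): (meetx_le p (pdeg y)); lia.
have [F _] := boundary_pathP x; have [Fy _] := boundary_pathP y.
have pdy : xdle p (pdeg y) by rewrite -py meetx_xdle.
(* By [e1] the vertex y(p) is x(n /\ d(x)), and the directions of [c] are those in which [n] exceeds
   d(x). There [x] has ended, so the boundary condition excludes edges. *)
have qy : q /\_ y = p.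
  apply: meetx_sink => // i pqi; rewrite -{1}py e1.
  have [_ bd] := boundary_pathP x; apply: bd; first exact: meetx_xdle.
  have : (0 < dsub n (n /\_ x) i)%N by rewrite -e3 dsubE subn_gt0.
  by rewrite !dsubE meetxE; case: (pdeg x i) => [a|]; [move=> h; congr Some; lia | lia].
apply/cls_pathP; rewrite nn py qy !dsubnn; split=> //.
by rewrite (ppath_id Fy) // (ppath_id F) ?meetx_xdle // -e1 py.
Qed.

Lemma ds_no_source (v : ds_obj L) n : exists c, ds_rng c = v /\ ds_deg c = n.
Proof.
have [x [m ->]] := cls_obj_surj v; exists (cls_path x (dle_addr m n)).
by rewrite ds_rng_cls ds_deg_cls dsub_addl.
Qed.

Lemma ds_factor c n : dle n (ds_deg c) -> exists f g,
  [/\ ds_deg f = n, ds_src f = ds_rng g & c = ds_comp f g].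
Proof.
have [x [m [l [ml ->]]]] := cls_path_surj c; rewrite ds_deg_cls => nl.
have h : dle (m + n) l.
  apply/dleP=> i; move/dleP/(_ i): ml; move/dleP/(_ i): nl; rewrite !degE; lia.
exists (cls_path x (dle_addr m n)), (cls_path x h).
rewrite ds_deg_cls dsub_addl ds_src_cls ds_rng_cls ds_comp_cls; split=> //.
by congr cls_path; exact: bool_irrelevance.
Qed.

Lemma ds_deg0 c : ds_deg c = 0 -> c = ds_id (ds_rng c).
Proof.
have [x [m [l [ml ->]]]] := cls_path_surj c; rewrite ds_deg_cls ds_rng_cls ds_id_cls.
move=> d; have e : l = m.
  by apply/degP=> i; move/degP/(_ i): d; move/dleP/(_ i): ml; rewrite degE deg0; lia.
by subst l; congr cls_path; exact: bool_irrelevance.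
Qed.

Lemma ds_rng_id v : ds_rng (ds_id v) = v :> ds_obj L.
Proof. by have [x [m ->]] := cls_obj_surj v; rewrite ds_id_cls ds_rng_cls. Qed.

Lemma ds_src_id v : ds_src (ds_id v) = v :> ds_obj L.
Proof. by have [x [m ->]] := cls_obj_surj v; rewrite ds_id_cls ds_src_cls. Qed.

(** * The image of the canonical embedding *)

Section Embedding.
Hypotheses (k_gt0 : (0 < k)%N) (Llc : locally_convex L).
Variables (iota0 : obj L -> obj (desource L)) (iota1 : kpath L -> kpath (desource L)).
Hypothesis iotaP : canonical_embedding iota0 iota1.

Lemma iota1_ppath x n : xdle n (pdeg x) ->
  iota1 (ppath x 0 n) = cls_path x (dle0 n).
Proof.
move=> nx; have [F _] := boundary_pathP x.
rewrite (iotaP.2 _ _ _ _ (is_concat_shift nx)).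
  move: (dle0 (deg _)); rewrite (deg_ppath F) ?dle0 // dsubn0 => h.
  by congr cls_path; exact: bool_irrelevance.
by rewrite /= addr0 (src_ppath F) ?dle0.
Qed.

(** The object part of the embedding is specified only through identities, so the vertex is
    recovered as the range of the image of an identity. *)
Lemma iota0_pobj x : iota0 (pobj x 0) = cls_obj x 0.
Proof.
have [F _] := boundary_pathP x; rewrite -[LHS]ds_rng_id.
rewrite (_ : ds_id _ = iota1 (idp (pobj x 0))); last by rewrite iotaP.1.
by rewrite -(ppath_id F) ?xdle0 // iota1_ppath ?xdle0 // ds_rng_cls.
Qed.

(** A vertex in the image has the form [x;0] and so has zero excess. Hence the starting degree of
    [c] does not exceed the degree of its boundary path, and the path can be rebased at 0. *)
Lemma rng_in_iota0 c : range iota0 (ds_rng c) ->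
  exists x n, c = cls_path x (dle0 n).
Proof.
have [y [m [n [mn ->]]]] := cls_path_surj c; rewrite ds_rng_cls => -[v _].
have [x <-] := boundary_path_exists k_gt0 Llc v.
rewrite iota0_pobj => /cls_objP[_]; rewrite (meetx_id (xdle0 _)) dsubnn => e.
have my : xdle m (pdeg y).
  suff <- : m /\_ y = m by exact: meetx_xdle.
  apply/degP=> i; move/degP/(_ i): e; rewrite !degE.
  by move/dleP/(_ i): (meetx_le m (pdeg y)); lia.
by rewrite (cls_path_shift mn my); eexists _, _.
Qed.

(** The vertex [x;n] is the source of [x;(0,n)]. This fullness of the image is what makes [psi]
    surjective. *)
Lemma src_from_iota0 (w : ds_obj L) : exists c, range iota0 (ds_rng c) /\ ds_src c = w.
Proof.
have [x [n ->]] := cls_obj_surj w; exists (cls_path x (dle0 n)).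
by rewrite ds_rng_cls ds_src_cls; split=> //; exists (pobj x 0); rewrite ?iota0_pobj.
Qed.

(** Continue [l] to a boundary path [x]: the source [x;d(l)] equals [y;0], where [y] is the shift of
    [x] by d(l). *)
Lemma src_iota1_iota0 l : range iota0 (ds_src (iota1 l)).
Proof.
have [x [lx <-]] := boundary_path_through k_gt0 Llc l.
rewrite iota1_ppath // ds_src_cls; have := iota0_pobj (BoundaryPath (shift_boundary lx)).
rewrite /= addr0 => e; exists (pobj x (deg l)) => //; rewrite e.
apply/cls_objP; rewrite (meetx_id (xdle0 _)) (meetx_id lx) !dsubnn /=.
by rewrite addr0.
Qed.

Lemma rng_iota1_iota0 l : range iota0 (ds_rng (iota1 l)).
Proof.
have [x [lx <-]] := boundary_path_through k_gt0 Llc l.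
by rewrite iota1_ppath // ds_rng_cls -iota0_pobj; exists (pobj x 0).
Qed.

(* In the paper's notation [f = iota(a) c] and [g = iota(b) c], where
   [f = [x;(0,n)]] has [a = x(0, n /\ d(x))] and [c = [x;(n /\ d(x), n)]]. *)
Lemma common_tail (f g : kpath (desource L)) :
  range iota0 (rng f) -> range iota0 (rng g) -> src f = src g ->
  exists (a b : kpath L) (c : kpath (desource L)),
  [/\ src (iota1 a) = rng c, src (iota1 b) = rng c,
      f = kcomp (iota1 a) c, g = kcomp (iota1 b) c
    & forall c' : kpath (desource L), rng c' = rng c -> deg c' = deg c -> c' = c].
Proof.
rewrite /src /rng /kcomp /deg /=.
move=> /rng_in_iota0[x [n ->]] /rng_in_iota0[y [p ->]]; rewrite !ds_src_cls.
move=> /cls_objP[e1 e2].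
exists (ppath x 0 (n /\_ x)), (ppath y 0 (p /\_ y)), (cls_path x (meetx_le n (pdeg x))).
(* The common source gives both tails the same range and the same degree, so [tail_uniq] identifies
   them. *)
have e : cls_path x (meetx_le n (pdeg x)) = cls_path y (meetx_le p (pdeg y)).
  symmetry; apply: tail_uniq; rewrite ?ds_rng_cls ?ds_deg_cls //.
  by apply/cls_objP; rewrite !(meetx_id (meetx_xdle _ _)) !dsubnn.
(* The tail is rewritten along [y] only in the two clauses about [b], so that each composite runs
   along one boundary path. *)
rewrite !iota1_ppath ?meetx_xdle // !ds_src_cls {2 4}e !ds_rng_cls !ds_comp_cls.
split=> //; try by congr cls_path; exact: bool_irrelevance.
by move=> c; rewrite ds_deg_cls; exact: tail_uniq.
Qed.

End Embedding.

End Desource.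

(** * Spans in a Kumjian-Pask algebra *)

Section NuAlg.
Context {R : comPzRingType} {A : nuAlgType R}.
Implicit Types (a b u v : A) (X Y Z : set A).

Lemma num0l a : 0 ** a = 0 :> A.
Proof. by apply: (@addrI _ (0 ** a)); rewrite -numulDl !addr0. Qed.

Lemma num0r a : a ** 0 = 0 :> A.
Proof. by apply: (@addrI _ (a ** 0)); rewrite -numulDr !addr0. Qed.

Lemma num_suml a (I : Type) (s : seq I) (F : I -> A) :
  a ** (\sum_(i <- s) F i) = \sum_(i <- s) a ** F i.
Proof. by elim/big_rec2: _ => [|i x y _ <-]; rewrite ?num0r ?numulDr. Qed.

Lemma num_sumr a (I : Type) (s : seq I) (F : I -> A) :
  (\sum_(i <- s) F i) ** a = \sum_(i <- s) F i ** a.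
Proof. by elim/big_rec2: _ => [|i x y _ <-]; rewrite ?num0l ?numulDl. Qed.

Lemma lspan_gen X a : X a -> a \in in_lspan X.
Proof.
move=> Xa; apply/asboolP; exists 1%N, (fun=> 1), (fun=> a); split=> //.
by rewrite big_ord1 scale1r.
Qed.

Lemma lspan_min X (W : set A) : is_submodule W -> X `<=` W ->
  forall a, a \in in_lspan X -> W a.
Proof.
move=> [W0 WD WZ] XW a /asboolP[n [c [u [Xu ->]]]].
by elim/big_ind: _ => // i _; apply: WZ; apply: XW.
Qed.

Lemma lspan_submodule X : is_submodule [set a | a \in in_lspan X].
Proof.
split=> [|u v Xu Xv|c u Xu] /=; [exact: rpred0 | exact: rpredD | exact: rpredZ].
Qed.

Lemma lspan_mul X Y Z : (forall a b, X a -> Y b -> a ** b \in in_lspan Z) ->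
  forall a b, a \in in_lspan X -> b \in in_lspan Y -> a ** b \in in_lspan Z.
Proof.
move=> XYZ a b Xa Yb; have [Z0 ZD ZZ] := lspan_submodule Z.
apply: (@lspan_min X [set a | a ** b \in in_lspan Z]) Xa => [|{}a Xa] /=.
  by split=> [|u v|c u] /=; rewrite ?num0l ?numulDl -?nuscaleAl; [|exact: ZD|exact: ZZ].
apply: (@lspan_min Y [set b | a ** b \in in_lspan Z]) Yb => [|{}b Yb] /=; last exact: XYZ.
by split=> [|u v|c u] /=; rewrite ?num0r ?numulDr -?nuscaleAr; [|exact: ZD|exact: ZZ].
Qed.

End NuAlg.

(* What the computations in a Kumjian-Pask algebra use of a k-graph without
   sources. *)
Record sourceless_axioms (k : nat) (G : kgraph_data k) : Prop := SourcelessAxioms {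
  sl_rng_id : forall v : obj G, rng (idp v) = v;
  sl_src_id : forall v : obj G, src (idp v) = v;
  sl_rng_comp : forall l mu : kpath G, src l = rng mu -> rng (kcomp l mu) = rng l;
  sl_deg0 : forall l : kpath G, deg l = 0 -> l = idp (rng l);
  sl_no_source : forall (v : obj G) (n : degree k), exists l, rng l = v /\ deg l = n;
  sl_factor : forall (l : kpath G) (n : degree k), dle n (deg l) -> exists f g,
    [/\ deg f = n, src f = rng g & l = kcomp f g] }.

Lemma desource_sourceless (k : nat) (L : kgraph k) : sourceless_axioms (desource L).
Proof.
split; [exact: ds_rng_id | exact: ds_src_id | by move=> *; exact: ds_rng_comp | exact: ds_deg0
  | exact: ds_no_source | exact: ds_factor].
Qed.

Section KPSpan.
Context {k : nat} (k_gt0 : (0 < k)%N) {G : kgraph_data k} {R : comPzRingType}.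
Context {A : nuAlgType R} {P : obj G -> A} {S Sst : kpath G -> A}.
Hypotheses (fam : KP_family P S Sst) (sl : sourceless_axioms G).
Implicit Types (l mu nu rho : kpath G) (n : degree k) (U V W : set (obj G)).

(** Without sources no path may stop short of [n] in any coordinate, so [KP3] and [KP4] concern the
    paths of degree exactly [n]. *)
Lemma le_paths_deg n l : le_paths n l <-> deg l = n.
Proof.
split=> [[/dleP ln h]|<-]; last first.
  by split=> [|i]; rewrite ?ltnn // dle_refl.
apply/degP=> i; apply/eqP; rewrite eqn_leq ln leqNgt; apply/negP=> /h e.
by have [c cP] := sl_no_source sl (src l) (unitd i); have : set0 c by rewrite -e.
Qed.

(** Extends [KP3] to degree 0, where both paths are identities and [KP1] applies. *)
Lemma KP_orth l mu : deg l = deg mu ->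
  Sst l ** S mu = if l == mu then P (src l) else 0.
Proof.
move=> e; have [d0|d0] := eqVneq (deg l) 0; last first.
  by apply: (KP3 fam d0); apply/le_paths_deg.
rewrite (sl_deg0 sl d0) (sl_deg0 sl (etrans (esym e) d0)).
rewrite (KP_Sst_id fam) (KP_S_id fam) (KP1 fam) (sl_src_id sl).
have [->|ne] := eqVneq (rng l) (rng mu); first by rewrite eqxx.
by case: eqP => // /(congr1 rng); rewrite !(sl_rng_id sl) => /eqP; rewrite (negPf ne).
Qed.

(** Generators of the space [E U W]. *)
Definition spanning U W : set A :=
  [set a | exists l mu, [/\ U (rng l), W (rng mu) & a = S l ** Sst mu]].

Lemma KP_expand v n : n != 0 -> exists s : seq (kpath G),
  (forall l, l \in s -> rng l = v /\ deg l = n) /\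
  P v = \sum_(l <- s) S l ** Sst l.
Proof.
(* In the first case infinitely many summands are nonzero, and the sum is empty by convention. *)
move=> n0; rewrite (KP4 fam v n0); case: finite_supportP => [_|X XP _ _].
  by exists [::].
by exists (finmap.enum_fset X); split=> // l /XP[lv /le_paths_deg ln].
Qed.

(** In each term of the expansion, factor [l] at [deg mu] and at [deg nu]. By orthogonality [Sst mu]
    strips [mu] from the front of [S l], and [S nu] strips [nu] from [Sst l], or the term is 0. *)
Lemma Sst_S mu nu : Sst mu ** S nu \in
  in_lspan [set a | exists l rho,
    [/\ rng l = src mu, rng rho = src nu & a = S l ** Sst rho]].
Proof.
set X := [set a | _]; have [X0 XD XZ] := lspan_submodule X.
(* The extra unit vector keeps [n] nonzero, as [KP4] requires, even when both degrees are 0. *)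
pose n := deg mu + deg nu + unitd (Ordinal k_gt0).
have mn : dle (deg mu) n by apply/dleP=> i; rewrite !degE; lia.
have nn : dle (deg nu) n by apply/dleP=> i; rewrite !degE; lia.
have n0 : n != 0.
  apply/eqP=> /degP/(_ (Ordinal k_gt0)); rewrite !degE unitdE eqxx; lia.
have [s [sP e]] := KP_expand (rng mu) n0.
rewrite -(KP2_rng_st fam) e num_suml num_sumr.
rewrite big_seq; elim/big_ind: _ => // l ls.
have [_ ld] := sP l ls.
have [l1 [l2 [d1 s1 e1]]] : exists f g,
    [/\ deg f = deg mu, src f = rng g & l = kcomp f g].
  by apply: (sl_factor sl); rewrite ld.
have [l3 [l4 [d3 s3 e3]]] : exists f g,
    [/\ deg f = deg nu, src f = rng g & l = kcomp f g].
  by apply: (sl_factor sl); rewrite ld.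
rewrite numulA -numulA.
have -> : Sst mu ** S l = if mu == l1 then S l2 else 0.
  rewrite e1 -(KP2_comp fam s1) numulA KP_orth //.
  case: eqP => [->|_]; last by rewrite num0l.
  by rewrite s1 (KP2_rng fam).
have -> : Sst l ** S nu = if l3 == nu then Sst l4 else 0.
  rewrite e3 -(KP2_comp_st fam s3) -numulA KP_orth //.
  case: eqP => [_|_]; last by rewrite num0r.
  by rewrite s3 (KP2_rng_st fam).
have [e13|_] := eqVneq mu l1; last by rewrite num0l.
have [e24|_] := eqVneq l3 nu; last by rewrite num0r.
by apply: lspan_gen; exists l2, l4; rewrite e13 -e24.
Qed.

Lemma P_disjoint (v w : obj G) a b : a ** P v = a -> P w ** b = b -> v != w -> a ** b = 0.
Proof.
move=> <- <- vw; rewrite numulA -[a ** _ ** _]numulA (KP1 fam) (negPf vw).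
by rewrite num0r num0l.
Qed.

(** After the middle product is expanded, [l] and [rho] are only prolonged at their sources, so the
    outer ranges survive whatever [V] and [V'] are. *)
Lemma spanning_mul U V V' W a b :
  a \in in_lspan (spanning U V) -> b \in in_lspan (spanning V' W) ->
  a ** b \in in_lspan (spanning U W).
Proof.
apply: lspan_mul => {}a {}b [l [mu [Ul _ ->]]] [nu [rho [_ Wrho ->]]].
have [X0 XD XZ] := lspan_submodule (spanning U W).
rewrite numulA -[S l ** _ ** _]numulA.
apply: (@lspan_min R A _
  [set c | S l ** c ** Sst rho \in in_lspan (spanning U W)] _ _ _ (Sst_S mu nu)).
  split=> [|u v|c u] /=.
  - by rewrite num0r num0l.
  - by rewrite numulDr numulDl; exact: XD.
  - by rewrite -nuscaleAr -nuscaleAl; exact: XZ.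
move=> _ [f [g [_ _ ->]]] /=; rewrite numulA -numulA.
have [lf|lf] := eqVneq (src l) (rng f); last first.
  by rewrite (P_disjoint (KP2_src fam l) (KP2_rng fam f) lf) num0l.
have [rg|rg] := eqVneq (rng g) (src rho); last first.
  by rewrite (P_disjoint (KP2_rng_st fam g) (KP2_src_st fam rho) rg) num0r.
rewrite (KP2_comp fam lf) (KP2_comp_st fam (esym rg)); apply: lspan_gen.
by exists (kcomp l f), (kcomp rho g); rewrite !(sl_rng_comp sl) ?rg.
Qed.

Lemma S_spanning l : S l = S l ** Sst (idp (src l)).
Proof. by rewrite (KP_Sst_id fam) (KP2_src fam). Qed.

Lemma Sst_spanning l : Sst l = S (idp (src l)) ** Sst l.
Proof. by rewrite (KP_S_id fam) (KP2_src_st fam). Qed.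

Lemma P_spanning v : P v = S (idp v) ** Sst (idp v).
Proof. by rewrite (KP_S_id fam) (KP_Sst_id fam) (KP1 fam) eqxx. Qed.

Lemma S_mem U W l : U (rng l) -> W (src l) -> S l \in in_lspan (spanning U W).
Proof.
by move=> Ul Wl; apply: lspan_gen; exists l, (idp (src l));
  rewrite (sl_rng_id sl) -S_spanning.
Qed.

Lemma Sst_mem U W l : U (src l) -> W (rng l) -> Sst l \in in_lspan (spanning U W).
Proof.
by move=> Ul Wl; apply: lspan_gen; exists (idp (src l)), l;
  rewrite (sl_rng_id sl) -Sst_spanning.
Qed.

Lemma P_mem U W v : U v -> W v -> P v \in in_lspan (spanning U W).
Proof.
by move=> Ul Wl; apply: lspan_gen; exists (idp v), (idp v);
  rewrite (sl_rng_id sl) -P_spanning.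
Qed.

Lemma spanning_subalgebra U V :
  is_subalgebra [set a | a \in in_lspan (spanning U V)].
Proof. by split=> [|x y]; [exact: lspan_submodule | exact: spanning_mul]. Qed.

Lemma spanning_setT : subalgebra_gen (range P `|` range S `|` range Sst) = setT ->
  forall a, a \in in_lspan (spanning setT setT).
Proof.
move=> gen a; have : subalgebra_gen (range P `|` range S `|` range Sst) a by rewrite gen.
move=> /(_ _ (spanning_subalgebra setT setT)); apply.
move=> _ [[[v _ <-]|[l _ <-]]|[l _ <-]] /=.
- exact: P_mem.
- exact: S_mem.
- exact: Sst_mem.
Qed.

Lemma S_Sst_eq0 l mu : src l != src mu -> S l ** Sst mu = 0.
Proof.
exact: P_disjoint (KP2_src fam l) (KP2_src_st fam mu).
Qed.

(** The inner product [Sst nu ** S nu] is the projection at the source of [l], which [S l] absorbs.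
    Both surjectivity proofs rest on this splitting. *)
Lemma S_Sst_insert l mu nu : src nu = src l ->
  S l ** Sst mu = (S l ** Sst nu) ** (S nu ** Sst mu).
Proof.
move=> e; rewrite numulA -[S l ** _ ** _]numulA KP_orth // eqxx e.
by rewrite (KP2_src fam).
Qed.

(** The expansion of [KP4] at the degree of [l] has [l] as its only term; in degree 0 the path is an
    identity. *)
Lemma P_uniq_path l :
  (forall l', rng l' = rng l -> deg l' = deg l -> l' = l) -> S l ** Sst l = P (rng l).
Proof.
move=> lu; have [d0|d0] := eqVneq (deg l) 0.
  by rewrite {1 2}(sl_deg0 sl d0) -P_spanning.
rewrite (KP4 fam _ d0) (_ : le_paths_from _ _ = [set l]) ?fsbig_set1 //.
apply/predeqP => l'; split=> [[lr /le_paths_deg ld]|->]; first exact: lu.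
by split=> //; apply/le_paths_deg.
Qed.

End KPSpan.

(** * Morita contexts of subspaces *)

Section TensorLift.
Context {A B C : nuRingType} {M N V : zmodType}.
Context {bM : bimodule A B M} {bN : bimodule B C N}.

Lemma tensor_additive_ext (f g : tensor bM bN -> V) :
    {morph f : t u / t + u} -> {morph g : t u / t + u} ->
  (forall m n, f (tens bM bN m n) = g (tens bM bN m n)) -> f =1 g.
Proof.
move=> fD gD fg t; have [s ->] := tensor_of_surj t.
have h0 (h : tensor bM bN -> V) : {morph h : t u / t + u} -> h 0 = 0.
  by move=> hD; apply: (@addrI _ (h 0)); rewrite -hD !addr0.
elim: s => [|[m n] s IHs]; first by rewrite (_ : tensor_of _ _ [::] = 0) // !h0.
by rewrite tensor_of_cons fD gD fg IHs.
Qed.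

Variable beta : M -> N -> V.
Hypothesis betaDl : forall m m' n, beta (m + m') n = beta m n + beta m' n.
Hypothesis betaDr : forall m n n', beta m (n + n') = beta m n + beta m n'.
Hypothesis beta_bal : forall m b n, beta (ract bM m b) n = beta m (lact bN b n).

(** Evaluated on a chosen representative; [tensor_lift_of] shows by induction on the tensor
    congruence that every representative gives the same value. *)
Definition tensor_lift (t : tensor bM bN) : V := \sum_(p <- repr t) beta p.1 p.2.

Lemma tensor_lift_of s :
  tensor_lift (tensor_of bM bN s) = \sum_(p <- s) beta p.1 p.2.
Proof.
have eqv u v : tensor_eqv bM bN u v ->
    \sum_(p <- u) beta p.1 p.2 = \sum_(p <- v) beta p.1 p.2.
  elim=> {u v} // [u v w _ -> _ -> //|u u' v v' _ e _ e'|u v|n|m m' n|m n n'|m b n].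
  - by rewrite !big_cat e e'.
  - by rewrite !big_cat /= addrC.
  - rewrite big_seq1 big_nil /=.
    by apply: (@addrI _ (beta 0 n)); rewrite -betaDl !addr0.
  - by rewrite !big_cons !big_nil /= betaDl !addr0.
  - by rewrite !big_cons !big_nil /= betaDr !addr0.
  - by rewrite !big_seq1 /= beta_bal.
by apply: eqv; apply/tensor_ofP; rewrite /tensor_of reprK.
Qed.

Lemma tensor_liftD : {morph tensor_lift : t u / t + u}.
Proof.
move=> t u; have [s ->] := tensor_of_surj t; have [s' ->] := tensor_of_surj u.
by rewrite tensor_ofD !tensor_lift_of big_cat.
Qed.

Lemma tensor_lift_tens m n : tensor_lift (tens bM bN m n) = beta m n.
Proof. by rewrite tensor_lift_of big_seq1. Qed.

End TensorLift.

(** * The Morita context of two subspaces whose products span *)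

Section SubspaceMorita.
Context {R : comPzRingType} {A : nuAlgType R} {X XM XN : set A}.
Hypothesis AM : forall a m : A, m \in in_lspan XM -> a ** m \in in_lspan XM.
Hypothesis MB : forall m b : A,
  m \in in_lspan XM -> b \in in_subalg X -> m ** b \in in_lspan XM.
Hypothesis BN : forall b n : A,
  b \in in_subalg X -> n \in in_lspan XN -> b ** n \in in_lspan XN.
Hypothesis NA : forall n a : A, n \in in_lspan XN -> n ** a \in in_lspan XN.
Hypothesis NM : forall n m : A,
  n \in in_lspan XN -> m \in in_lspan XM -> n ** m \in in_subalg X.
Hypothesis MN_full : forall a : A,
  a \in in_lspan [set c | exists m n, [/\ XM m, XN n & c = m ** n]].
Hypothesis NM_full : forall b : A, b \in in_subalg X ->
  b \in in_lspan [set c | exists n m, [/\ XN n, XM m & c = n ** m]].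

Local Notation B := (gen_subalg X).
Local Notation M := (lspan XM).
Local Notation N := (lspan XN).

Definition sub_lactM (a : A) (m : M) : M := LSpan (AM a (lspan_valP m)).
Definition sub_ractM (m : M) (b : B) : M := LSpan (MB (lspan_valP m) (gen_subalg_valP b)).
Definition sub_lactN (b : B) (n : N) : N := LSpan (BN (gen_subalg_valP b) (lspan_valP n)).
Definition sub_ractN (n : N) (a : A) : N := LSpan (NA a (lspan_valP n)).

(** Kept transparent, so that the actions reduce to multiplication in [A] by computation. *)
Definition sub_bimoduleM : bimodule A B M.
Proof.
by refine (@Bimodule A B M sub_lactM sub_ractM _ _ _ _ _ _ _) => *;
  apply: val_inj; rewrite /= ?numulDl ?numulDr ?numulA.
Defined.

Definition sub_bimoduleN : bimodule B A N.
Proof.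
by refine (@Bimodule B A N sub_lactN sub_ractN _ _ _ _ _ _ _) => *;
  apply: val_inj; rewrite /= ?numulDl ?numulDr ?numulA.
Defined.

Definition sub_mulMN (m : M) (n : N) : A := val m ** val n.
Definition sub_mulNM (n : N) (m : M) : B := GenSubalg (NM (lspan_valP n) (lspan_valP m)).

Local Notation psi := (@tensor_lift _ _ _ _ _ _ sub_bimoduleM sub_bimoduleN sub_mulMN).
Local Notation phi := (@tensor_lift _ _ _ _ _ _ sub_bimoduleN sub_bimoduleM sub_mulNM).

Let mulMN_Dl m m' n : sub_mulMN (m + m') n = sub_mulMN m n + sub_mulMN m' n.
Proof. by rewrite /sub_mulMN /= numulDl. Qed.
Let mulMN_Dr m n n' : sub_mulMN m (n + n') = sub_mulMN m n + sub_mulMN m n'.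
Proof. by rewrite /sub_mulMN /= numulDr. Qed.
Let mulMN_bal m b n :
  sub_mulMN (ract sub_bimoduleM m b) n = sub_mulMN m (lact sub_bimoduleN b n).
Proof. by rewrite /sub_mulMN /= numulA. Qed.
Let mulNM_Dl n n' m : sub_mulNM (n + n') m = sub_mulNM n m + sub_mulNM n' m.
Proof. by apply: val_inj; rewrite /= numulDl. Qed.
Let mulNM_Dr n m m' : sub_mulNM n (m + m') = sub_mulNM n m + sub_mulNM n m'.
Proof. by apply: val_inj; rewrite /= numulDr. Qed.
Let mulNM_bal n a m :
  sub_mulNM (ract sub_bimoduleN n a) m = sub_mulNM n (lact sub_bimoduleM a m).
Proof. by apply: val_inj; rewrite /= numulA. Qed.

Let psiD := tensor_liftD mulMN_Dl mulMN_Dr mulMN_bal.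
Let phiD := tensor_liftD mulNM_Dl mulNM_Dr mulNM_bal.
Let psi_tens := tensor_lift_tens mulMN_Dl mulMN_Dr mulMN_bal.
Let phi_tens := tensor_lift_tens mulNM_Dl mulNM_Dr mulNM_bal.

(** The tensor product is only an abelian group here, so a scalar is absorbed into the first factor
    of each pure tensor. *)
Let psi_range_submodule : is_submodule (range psi).
Proof.
split.
- by exists (tensor_of _ _ [::]) => //; rewrite tensor_lift_of // big_nil.
- by move=> _ _ [t _ <-] [u _ <-]; exists (t + u) => //; exact: psiD.
move=> c _ [t _ <-]; have [s ->] := tensor_of_surj t.
rewrite tensor_lift_of //; elim: s => [|p s [u _ us]].
  by exists (tensor_of _ _ [::]) => //; rewrite tensor_lift_of // !big_nil scaler0.
exists (tens _ _ (c *: p.1) p.2 + u) => //.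
rewrite psiD psi_tens us big_cons scalerDr; congr (_ + _).
by rewrite /sub_mulMN /= nuscaleAl.
Qed.

Let phi_range_submodule : is_submodule [set val (phi t) | t in [set: _]].
Proof.
split.
- by exists (tensor_of _ _ [::]) => //; rewrite tensor_lift_of // big_nil.
- by move=> _ _ [t _ <-] [u _ <-]; exists (t + u) => //; rewrite phiD.
move=> c _ [t _ <-]; have [s ->] := tensor_of_surj t.
rewrite tensor_lift_of //; elim: s => [|p s [u _ us]].
  by exists (tensor_of _ _ [::]) => //; rewrite tensor_lift_of // !big_nil scaler0.
exists (tens _ _ (c *: p.1) p.2 + u) => //.
rewrite phiD phi_tens big_cons /= [val (phi u)]us scalerDr; congr (_ + _).
by rewrite nuscaleAl.
Qed.

(** Every identity reduces on pure tensors to associativity in [A]. For surjectivity, the ranges are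
    closed under linear combinations and contain the spanning products. *)
Lemma subspace_Morita : exists (bM : bimodule A B M) (bN : bimodule B A N),
    [/\ (forall (a : A) (m : M), val (lact bM a m) = a ** val m),
        (forall (m : M) (b : B), val (ract bM m b) = val m ** val b),
        (forall (b : B) (n : N), val (lact bN b n) = val b ** val n),
        (forall (n : N) (a : A), val (ract bN n a) = val n ** a)
      & exists (psi : tensor bM bN -> A) (phi : tensor bN bM -> B),
          [/\ (forall (m : M) (n : N), psi (tens bM bN m n) = val m ** val n),
              (forall (n : N) (m : M),
                 val (phi (tens bN bM n m)) = val n ** val m)
            & surjective_Morita_context psi phi]].
Proof.
exists sub_bimoduleM, sub_bimoduleN; split=> //.
exists psi, phi; split=> [m n|n m|]; rewrite ?psi_tens ?phi_tens //.
split; first split.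
- split; first exact: psiD.
  + move=> a t; move: t; apply: tensor_additive_ext => [t u|t u|m n] /=.
    * by rewrite tensor_lactD psiD.
    * by rewrite psiD numulDr.
    * by rewrite tensor_lact_tens !psi_tens /sub_mulMN /= numulA.
  + move=> t a; move: t; apply: tensor_additive_ext => [t u|t u|m n] /=.
    * by rewrite tensor_ractD psiD.
    * by rewrite psiD numulDl.
    * by rewrite tensor_ract_tens !psi_tens /sub_mulMN /= numulA.
- split; first exact: phiD.
  + move=> b t; move: t; apply: tensor_additive_ext => [t u|t u|n m] /=.
    * by rewrite tensor_lactD phiD.
    * by rewrite phiD numulDr.
    * by rewrite tensor_lact_tens !phi_tens; apply: val_inj; rewrite /= numulA.
  + move=> t b; move: t; apply: tensor_additive_ext => [t u|t u|n m] /=.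
    * by rewrite tensor_ractD phiD.
    * by rewrite phiD numulDl.
    * by rewrite tensor_ract_tens !phi_tens; apply: val_inj; rewrite /= numulA.
- move=> n' m n; rewrite psi_tens phi_tens; apply: val_inj.
  by rewrite /= /sub_mulMN numulA.
- move=> m' n m; rewrite psi_tens phi_tens; apply: val_inj.
  by rewrite /= /sub_mulMN numulA.
- apply/seteqP; split=> // a _.
  apply: (lspan_min psi_range_submodule _ (MN_full a)) => _ [m [n [Xm Xn ->]]].
  exists (tens _ _ (LSpan (lspan_gen Xm)) (LSpan (lspan_gen Xn))).
    by [].
  exact: psi_tens.
- apply/seteqP; split=> // b _.
  have [|t _ tb] := lspan_min phi_range_submodule _ (NM_full (gen_subalg_valP b)).
    move=> _ [n [m [Xn Xm ->]]].
    exists (tens _ _ (LSpan (lspan_gen Xn)) (LSpan (lspan_gen Xm))).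
      by [].
    by rewrite phi_tens.
  by exists t => //; apply: val_inj.
Qed.

End SubspaceMorita.

(** * The Morita context for the desourcification *)

Theorem theorem7p4 (k : nat) (k_gt0 : (0 < k)%N)
    (L : kgraph k) (L_row_finite : row_finite L)
    (L_locally_convex : locally_convex L)
    (iota0 : obj L -> obj (desource L)) (iota1 : kpath L -> kpath (desource L))
    (iotaP : canonical_embedding iota0 iota1)
    (R : comPzRingType) (KP : nuAlgType R)
    (q : obj (desource L) -> KP) (t tst : kpath (desource L) -> KP)
    (qtP : universal_KP_family q t tst) :
  let B := gen_subalg ([set q (iota0 v) | v in [set: obj L]]
                   `|` [set t (iota1 l) | l in [set: kpath L]]
                   `|` [set tst (iota1 mu) | mu in [set: kpath L]]) in
  let M := lspan [set a : KP | exists l mu : kpath (desource L),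
                   range iota0 (rng mu) /\ a = t l ** tst mu] in
  let N := lspan [set a : KP | exists l mu : kpath (desource L),
                   range iota0 (rng l) /\ a = t l ** tst mu] in
  exists (bM : bimodule KP B M) (bN : bimodule B KP N),
    [/\ (forall (a : KP) (m : M), val (lact bM a m) = a ** val m),
        (forall (m : M) (b : B), val (ract bM m b) = val m ** val b),
        (forall (b : B) (n : N), val (lact bN b n) = val b ** val n),
        (forall (n : N) (a : KP), val (ract bN n a) = val n ** a)
      & exists (psi : tensor bM bN -> KP) (phi : tensor bN bM -> B),
          [/\ (forall (m : M) (n : N), psi (tens bM bN m n) = val m ** val n),
              (forall (n : N) (m : M),
                 val (phi (tens bN bM n m)) = val n ** val m)
            & surjective_Morita_context psi phi]].
Proof.
have [fam gen _] := qtP.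
have sl := desource_sourceless L.
pose span := @spanning k (desource L) R KP t tst; pose V := range iota0.
have spanM : [set a : KP | exists l mu : kpath (desource L),
    range iota0 (rng mu) /\ a = t l ** tst mu] = span setT V.
  by apply/predeqP=> a; split=> [[l [mu [Vmu ->]]]|[l [mu [_ Vmu ->]]]]; exists l, mu.
have spanN : [set a : KP | exists l mu : kpath (desource L),
    range iota0 (rng l) /\ a = t l ** tst mu] = span V setT.
  by apply/predeqP=> a; split=> [[l [mu [Vl ->]]]|[l [mu [Vl _ ->]]]]; exists l, mu.
have full a : a \in in_lspan (span setT setT).
  exact: (spanning_setT k_gt0 fam sl gen).
have mul U W U' W' a b : a \in in_lspan (span U W) -> b \in in_lspan (span U' W') ->
    a ** b \in in_lspan (span U W').
  exact: (spanning_mul k_gt0 fam sl).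
have orth0 l mu : src l != src mu -> t l ** tst mu = 0.
  exact: (S_Sst_eq0 fam).
move=> B M N; rewrite {}/B {}/M {}/N; set X := _ `|` _.
have B_span b : b \in in_subalg X -> b \in in_lspan (span V V).
  move=> /asboolP/(_ [set a | a \in in_lspan (span V V)]); apply.
    by split=> [|x y]; [exact: lspan_submodule | exact: mul].
  move=> _ [[[v _ <-]|[l _ <-]]|[l _ <-]] /=.
  - by apply: (P_mem fam sl); exists v.
  - apply: (S_mem fam sl).
      exact (rng_iota1_iota0 k_gt0 L_locally_convex iotaP l).
    exact (src_iota1_iota0 k_gt0 L_locally_convex iotaP l).
  - apply: (Sst_mem fam sl).
      exact (src_iota1_iota0 k_gt0 L_locally_convex iotaP l).
    exact (rng_iota1_iota0 k_gt0 L_locally_convex iotaP l).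
have span_B b : b \in in_lspan (span V V) -> b \in in_subalg X.
  apply: (@lspan_min R KP _ [set b | b \in in_subalg X]).
    by split=> [|u v Xu Xv|c u Xu] /=; [exact: rpred0 | exact: rpredD | exact: rpredZ].
  move=> _ [l [mu [Vl Vmu ->]]] /=.
  have [e|ne] := eqVneq (src l) (src mu); last by rewrite orth0 // rpred0.
  have [a [c [f [af cf -> -> fu]]]] :=
    common_tail k_gt0 L_locally_convex iotaP Vl Vmu e.
  (* The common tail [f] cancels: [t f ** tst f] is the projection at its range, which [t (iota1 a)]
     absorbs. *)
  rewrite -(KP2_comp fam af) -(KP2_comp_st fam cf) numulA -[_ ** _ ** tst f]numulA.
  rewrite (P_uniq_path fam sl fu) -af (KP2_src fam (iota1 a)).
  apply: in_subalgM; apply/asboolP=> W _ XW; apply: XW.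
    by left; right; exists a.
  by right; exists c.
have insert l mu nu : ds_src nu = ds_src l ->
    t l ** tst mu = (t l ** tst nu) ** (t nu ** tst mu).
  exact: (S_Sst_insert fam sl).
rewrite spanM spanN; apply: subspace_Morita.
- by move=> a m; apply: mul.
- by move=> m b mM /B_span; apply: mul.
- by move=> b n /B_span; apply: mul.
- by move=> n a nN; apply: mul nN (full a).
- by move=> n m nN mM; apply: span_B; apply: mul nN mM.
- move=> a; apply: (@lspan_min R KP _ _ (lspan_submodule _) _ _ (full a)).
  move=> _ [l [mu [_ _ ->]]] /=.
  (* Since [c] starts in [V], the two factors of the splitting at [c] lie in [M] and in [N]. *)
  have [c [Vc cl]] := src_from_iota0 iotaP (ds_src l).
  rewrite (insert l mu c cl); apply: lspan_gen.
  exists (t l ** tst c), (t c ** tst mu); split=> //.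
    by exists l, c.
  by exists c, mu.
- move=> b /B_span; apply: (@lspan_min R KP _ _ (lspan_submodule _)).
  move=> _ [l [mu [Vl Vmu ->]]] /=.
  (* Here [l] and [mu] already start in [V], so the splitting can be made at the identity of the
     source of [l]. *)
  have e : ds_src (ds_id (ds_src l)) = ds_src l by rewrite ds_src_id.
  rewrite (insert l mu _ e); apply: lspan_gen.
  exists (t l ** tst (ds_id (ds_src l))), (t (ds_id (ds_src l)) ** tst mu); split=> //.
    by exists l, (ds_id (ds_src l)).
  by exists (ds_id (ds_src l)), mu.
Qed.
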